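(* Let $m$ be a positive integer and let $(K,\partial_0,\dots,\partial_{m-1})$ be a field with $m$ commuting derivations. Let $n$ and $r$ be positive integers, and suppose $K$ has a field extension $K(a_h^{\xi}\colon|\xi|\le 2r\land h<n)$ that meets the differential condition. Suppose further that for each $k<n$, either $|\sigma|\le r$ whenever $a_k^{\sigma}$ is a minimal separable leader, or else there is some $\tau\in\mathbb{N}^m$ with $|\tau|=2r$ such that $\sigma\le\tau$ whenever $a_k^{\sigma}$ is a minimal separable leader. Then $(K,\partial_0,\dots,\partial_{m-1})$ has an extension $(M,D_0,\dots,D_{m-1})$ (a field $M\supseteq K$ with $m$ commuting derivations extending the $\partial_i$) compatible with $K(a_h^{\xi}\colon|\xi|<2r\land h<n)$, i.e. $K(a_h^{\xi}\colon|\xi|<2r\land h<n)\subseteq M$ and $D_ia_k^{\sigma}=a_k^{\sigma+\varepsilon_i}$ whenever $i<m$, $k<n$ and $|\sigma|+1<2r$.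
   Context: $n$ denotes also $\{0,\dots,n-1\}$. For $\sigma\in\mathbb{N}^m$, $|\sigma|=\sum_{i<m}\sigma(i)$; $\le$ is the componentwise order on $\mathbb{N}^m$; $\varepsilon_i$ is the characteristic function of $\{i\}$ in $\mathbb{N}^m$. The total order $\unlhd$ on $\mathbb{N}^m\times n$: $(\xi,k)\unlhd(\eta,g)$ iff $(|\xi|,k,\xi(0),\dots,\xi(m-2))$ is lexicographically $\le(|\eta|,g,\eta(0),\dots,\eta(m-2))$; $\lhd$ is the strict version. The extension meets the differential condition if: whenever $i<m$, $k<n$, $|\sigma|+1\le 2r$, and $f$ is a polynomial over $K$ in variables $(x_h^{\xi}\colon(\xi,h)\unlhd(\sigma,k))$ vanishing at $a=(a_h^{\xi}\colon(\xi,h)\unlhd(\sigma,k))$, then $\sum_{(\eta,g)\unlhd(\sigma,k)}\frac{\partial f}{\partial x_g^{\eta}}(a)\,a_g^{\eta+\varepsilon_i}+f^{\partial_i}(a)=0$, with $f^{\partial_i}$ being $f$ with $\partial_i$ applied to its coefficients. A generator $a_k^{\sigma}$ is a separable leader if it is separably algebraic over $K(a_h^{\xi}\colon(\xi,h)\lhd(\sigma,k))$, and a minimal separable leader if in addition no $a_k^{\rho}$ with $\rho\le\sigma$, $\rho\ne\sigma$, is a separable leader. *)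

(* Defs.v *)
From HB Require Import structures.
From mathcomp Require Import all_boot all_order all_algebra.
From mathcomp Require Import separable mpoly.
Set Implicit Arguments. Unset Strict Implicit. Unset Printing Implicit Defensive.
Import Order.TTheory GRing.Theory.
Local Open Scope ring_scope.

Definition is_derivation (R : nzRingType) (D : R -> R) : Prop :=
  (forall x y, D (x + y) = D x + D y) /\ (forall x y, D (x * y) = D x * y + x * D y).

Definition commuting_derivations (R : nzRingType) (m : nat) (D : 'I_m -> R -> R) : Prop :=
  (forall i, is_derivation (D i)) /\ (forall i j x, D i (D j x) = D j (D i x)).

Inductive gen_field (L : fieldType) (S : L -> Prop) : L -> Prop :=
| gen_field_S x : S x -> gen_field S x
| gen_field_1 : gen_field S 1
| gen_field_add x y : gen_field S x -> gen_field S y -> gen_field S (x + y)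
| gen_field_opp x : gen_field S x -> gen_field S (- x)
| gen_field_mul x y : gen_field S x -> gen_field S y -> gen_field S (x * y)
| gen_field_inv x : gen_field S x -> gen_field S (x^-1).

Fixpoint lexle (s t : seq nat) : bool :=
  match s, t with
  | x :: s', y :: t' => (x < y)%N || ((x == y) && lexle s' t')
  | _, _ => true
  end.

Definition tri_key (m n : nat) (p : 'X_{1..m} * 'I_n) : seq nat :=
  mdeg p.1 :: nat_of_ord p.2 :: map (fun i : 'I_m => p.1 i) (filter (fun i : 'I_m => (i < m.-1)%N) (enum 'I_m)).

Definition tri_le (m n : nat) (p q : 'X_{1..m} * 'I_n) : bool :=
  lexle (tri_key p) (tri_key q).
Definition tri_lt (m n : nat) (p q : 'X_{1..m} * 'I_n) : bool :=
  tri_le p q && (p != q).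

Section Ext.
Variables (m n r : nat) (K L : fieldType) (iota : {rmorphism K -> L}).
Variable (a : 'X_{1..m} -> 'I_n -> L).

Definition var_t := ('X_{1..m < (2 * r).+1} * 'I_n)%type.
Definition nvars := #|{: var_t}|.
Definition var_of (j : 'I_nvars) : 'X_{1..m} * 'I_n :=
  let v := enum_val (j : 'I_#|{: var_t}|) in (bmnm v.1, v.2).

Definition apoint (j : 'I_nvars) : L := a (var_of j).1 (var_of j).2.

Definition eval_at (c : K -> L) (f : {mpoly K[nvars]}) : L := mmap c apoint f.

Definition poly_in_vars_le (sigma : 'X_{1..m}) (k : 'I_n) (f : {mpoly K[nvars]}) : Prop :=
  forall mono, mono \in msupp f -> forall j, (0 < mono j)%N -> tri_le (var_of j) (sigma, k).

Definition differential_condition (d : 'I_m -> K -> K) : Prop :=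
  forall (i : 'I_m) (k : 'I_n) (sigma : 'X_{1..m}), (mdeg sigma + 1 <= 2 * r)%N ->
  forall f : {mpoly K[nvars]}, poly_in_vars_le sigma k f ->
    eval_at iota f = 0 ->
    \sum_(j < nvars | tri_le (var_of j) (sigma, k))
        eval_at iota (f^`M(j)) * a ((var_of j).1 + U_(i))%MM (var_of j).2
      + eval_at (fun x => iota (d i x)) f = 0.

Definition sep_alg_over (F : L -> Prop) (x : L) : Prop :=
  exists p : {poly L}, [/\ p != 0, forall t, F p`_t, root p x & separable_poly p].

Definition field_below (sigma : 'X_{1..m}) (k : 'I_n) : L -> Prop :=
  gen_field (fun x => (exists c, x = iota c) \/
    exists xi h, [/\ (mdeg xi <= 2 * r)%N, tri_lt (xi, h) (sigma, k) & x = a xi h]).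

Definition sep_leader (k : 'I_n) (sigma : 'X_{1..m}) : Prop :=
  (mdeg sigma <= 2 * r)%N /\ sep_alg_over (field_below sigma k) (a sigma k).

Definition min_sep_leader (k : 'I_n) (sigma : 'X_{1..m}) : Prop :=
  sep_leader k sigma /\
  forall rho : 'X_{1..m}, (rho <= sigma)%MM -> rho != sigma -> ~ sep_leader k rho.

Definition field_lt2r : L -> Prop :=
  gen_field (fun x => (exists c, x = iota c) \/
    exists xi h, (mdeg xi < 2 * r)%N /\ x = a xi h).

End Ext.

(* Main.v *)
(* Let E = K(a_v : |v| < 2r). The differential condition provides derivations of E
   with values in the big field. Keep only the E-linear relations among the
   generators of level 2r and make the remaining ones, and all nonleaders of higher
   level, independent indeterminates over E: this gives a field M. An element
   b_v of M is then defined for every index v by recursion along the total order: a_v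
   below level 2r, the indeterminate for a nonleader, and D_j b_(v - e_j) for
   a leader v with v - e_j a leader, where D_i extends the i-th derivation of E and
   sends the indeterminate of w to b_(w + e_i).

   Everything rests on D_i b_v = b_(v + e_i), proved by induction along the order. The only
   conflict is between two leaders v - e_i and v - e_j lying above minimal leaders p
   and q. The hypothesis bounds the degree of the join of p and q by 2r, so above
   level 2r some v - e_l is still above the join and links both to it through
   leaders v - e_i - e_l and v - e_j - e_l. On such a leader x the bracket [D_i, D_l]
   vanishes: it is a derivation killing whatever precedes x, and b_x is a rational
   function of, or separably algebraic over, what precedes x. *)

Require Import Defs.
From HB Require Import structures.
From mathcomp Require Import all_boot all_order all_algebra.
From mathcomp Require Import separable mpoly ring zify boolp.
From mathcomp Require monalg finmap.
Set Implicit Arguments. Unset Strict Implicit. Unset Printing Implicit Defensive.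
Import GRing.Theory.
Local Open Scope ring_scope.
(** * Partial morphisms and derivations on generated subfields *)

Section GenField.
Variables (L : fieldType) (S : L -> Prop).

Lemma gen_field0 : gen_field S 0.
Proof.
by rewrite -(subrr 1); apply: gen_field_add (gen_field_opp _); apply: gen_field_1.
Qed.

Lemma gen_fieldX x n : gen_field S x -> gen_field S (x ^+ n).
Proof.
move=> Sx; elim: n => [|n IHn]; first exact: gen_field_1.
by rewrite exprS; apply: gen_field_mul.
Qed.

Lemma gen_field_sum (I : Type) (s : seq I) (P : pred I) (F : I -> L) :
  (forall i, P i -> gen_field S (F i)) -> gen_field S (\sum_(i <- s | P i) F i).
Proof.
move=> SF; apply: (big_ind (gen_field S)) => //; first exact: gen_field0.
exact: gen_field_add.
Qed.

Lemma gen_field_div x y : gen_field S x -> gen_field S y -> gen_field S (x / y).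
Proof. by move=> Sx Sy; apply/gen_field_mul/gen_field_inv. Qed.

Lemma gen_field_horner (p : {poly L}) x :
  (forall t, gen_field S p`_t) -> gen_field S x -> gen_field S p.[x].
Proof.
move=> Sp Sx; rewrite horner_coef; apply: gen_field_sum => i _.
by apply: gen_field_mul => //; apply: gen_fieldX.
Qed.

Lemma gen_field_deriv (p : {poly L}) x :
  (forall t, gen_field S p`_t) -> gen_field S x -> gen_field S p^`().[x].
Proof.
move=> Sp Sx; apply: gen_field_horner => // t; rewrite coef_deriv -mulr_natr.
apply: gen_field_mul => //; elim: t.+1 => [|k Sk]; first exact: gen_field0.
by rewrite -natr1; apply/gen_field_add/gen_field_1.
Qed.

Lemma gen_field_trans (S' : L -> Prop) x :
  (forall y, S' y -> gen_field S y) -> gen_field S' x -> gen_field S x.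
Proof.
move=> SS'; elim=> {x} [x /SS'||x y _ Sx _ Sy|x _ Sx|x y _ Sx _ Sy|x _ Sx] //.
- exact: gen_field_1.
- exact: gen_field_add.
- exact: gen_field_opp.
- exact: gen_field_mul.
- exact: gen_field_inv.
Qed.

End GenField.

(* Ring morphisms and derivations along them defined on a subset [E] only;
   outside [E] the functions take junk values. *)
Section Partial.
Variables (L C : fieldType).
Implicit Types (E : L -> Prop) (j del : L -> C) (T : C -> Prop).

Definition hom_on E j : Prop :=
  [/\ j 1 = 1, (forall x y, E x -> E y -> j (x + y) = j x + j y)
    & (forall x y, E x -> E y -> j (x * y) = j x * j y)].

Definition der_on E j del : Prop :=
  (forall x y, E x -> E y -> del (x + y) = del x + del y) /\
  (forall x y, E x -> E y -> del (x * y) = del x * j y + j x * del y).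

(** Closure under sums and under scaling by [j E]. With [T] zero, a subfield or a span, one
    induction gives uniqueness of derivations, bounds on where their values lie, and linearity of
    derivatives. *)
Definition submod E j T : Prop :=
  [/\ T 0, (forall x y, T x -> T y -> T (x + y))
    & (forall b x, E b -> T x -> T (j b * x))].

Lemma hom_onS E E' j : (forall x, E' x -> E x) -> hom_on E j -> hom_on E' j.
Proof. by move=> sE [j1 jD jM]; split=> // x y /sE Ex /sE Ey; [apply: jD|apply: jM]. Qed.

Lemma der_onS E E' j del :
  (forall x, E' x -> E x) -> der_on E j del -> der_on E' j del.
Proof. by move=> sE [dD dM]; split=> x y /sE Ex /sE Ey; [apply: dD|apply: dM]. Qed.

Section Subfield.
Variables (S : L -> Prop) (j del : L -> C).
Let E := gen_field S.
Hypothesis homj : hom_on E j.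

Lemma hom_on0 : j 0 = 0.
Proof.
case: homj => _ jD _; have E0 : E 0 := gen_field0 S.
by apply: (addrI (j 0)); rewrite -jD // !addr0.
Qed.

Lemma hom_onN x : E x -> j (- x) = - j x.
Proof.
case: homj => _ jD _ Ex; apply: (addrI (j x)).
by rewrite -jD ?subrr ?hom_on0 //; apply: gen_field_opp.
Qed.

Lemma hom_onV x : E x -> j x^-1 = (j x)^-1.
Proof.
case: homj => j1 _ jM Ex; have [->|x0] := eqVneq x 0; first by rewrite invr0 hom_on0 invr0.
have EV : E x^-1 by apply: gen_field_inv.
have := jM _ _ Ex EV; rewrite mulfV // j1 => /esym jxV.
have jx0 : j x != 0 by apply: contra_eq_neq jxV => ->; rewrite mul0r eq_sym oner_eq0.
by apply: (mulfI jx0); rewrite jxV mulfV.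
Qed.

Lemma hom_on_eq0 x : E x -> (j x == 0) = (x == 0).
Proof.
case: homj => j1 _ jM Ex; have [->|x0] := eqVneq x 0; first by rewrite hom_on0 eqxx.
have := jM _ _ Ex (gen_field_inv Ex); rewrite mulfV // j1 => /esym jxV.
by apply/negbTE; apply: contra_eq_neq jxV => ->; rewrite mul0r eq_sym oner_eq0.
Qed.

Lemma submodN T x : submod E j T -> T x -> T (- x).
Proof.
case=> _ _ TM Tx; rewrite -mulN1r; case: (homj) => j1 _ _.
have E1 : E 1 := gen_field_1 S.
rewrite -j1 -hom_onN //; apply: TM => //; exact: gen_field_opp.
Qed.

Hypothesis derd : der_on E j del.

Lemma der_on0 : del 0 = 0.
Proof.
case: derd => dD _; have E0 : E 0 := gen_field0 S.
by apply: (addrI (del 0)); rewrite -dD // !addr0.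
Qed.

Lemma der_on1 : del 1 = 0.
Proof.
case: derd => _ dM; case: homj => j1 _ _; have E1 : E 1 := gen_field_1 S.
have := dM _ _ E1 E1; rewrite mulr1 j1 mulr1 mul1r => e.
by apply: (addrI (del 1)); rewrite -e addr0.
Qed.

Lemma der_onN x : E x -> del (- x) = - del x.
Proof.
case: derd => dD _ Ex; apply: (addrI (del x)).
by rewrite -dD ?subrr ?der_on0 //; apply: gen_field_opp.
Qed.

Lemma der_onV x : E x -> del x^-1 = - (j x^-1 * j x^-1 * del x).
Proof.
move=> Ex; have [->|x0] := eqVneq x 0.
  by rewrite invr0 der_on0 mulr0 oppr0.
have EV : E x^-1 by apply: gen_field_inv.
case: derd => _ dM; have := dM _ _ EV Ex; rewrite mulVf // der_on1.
rewrite (hom_onV Ex) => /esym/eqP; rewrite addr_eq0 => /eqP e.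
have jx0 : j x != 0 by rewrite hom_on_eq0.
by apply: (mulIf jx0); rewrite e; field.
Qed.

(** The sum, product and inverse rules write [del x] as a [j E]-linear combination of the values of
    [del] on generators. *)
Lemma der_on_submod T : submod E j T -> (forall x, S x -> T (del x)) ->
  forall x, E x -> T (del x).
Proof.
move=> smT ST; have [T0 TD TM] := smT; have [dD dM] := derd.
move=> x; elim=> {x} [x /ST||x y Ex Tx Ey Ty|x Ex Tx|x y Ex Tx Ey Ty|x Ex Tx] //.
- by rewrite der_on1.
- by rewrite dD //; apply: TD.
- by rewrite der_onN //; apply: submodN.
- by rewrite dM // mulrC; apply: TD; apply: TM.
- rewrite der_onV // -mulrA; apply: submodN => //.
  by apply: (TM _ _ (gen_field_inv Ex)); apply: (TM _ _ (gen_field_inv Ex)).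
Qed.

(* From [p(x) = 0] one gets [p'(x) del x = - p^del(x)], and [p'(x)] is invertible. *)
Lemma der_on_sep T (A : L -> Prop) x :
  submod E j T -> (forall c, A c -> E c) -> (forall c, A c -> T (del c)) ->
  E x -> sep_alg_over A x -> T (del x).
Proof.
move=> smT AE AT Ex [p [p0 Ap px sepp]].
have [T0 TD TM] := smT; have [dD dM] := derd; have [j1 jD jM] := homj.
(* The difference is, up to [j], the polynomial [q] with [del] applied to its coefficients,
   evaluated at [x]. The induction follows Horner's scheme. *)
have key : forall q : {poly L}, (forall t, A q`_t) ->
    T (del q.[x] - j q^`().[x] * del x).
  elim/poly_ind => [|q c IHq] Aq.
    by rewrite deriv0 horner0 der_on0 hom_on0 mul0r subr0.
  have Aq' t : A q`_t by have := Aq t.+1; rewrite coefD coefMX coefC /= addr0.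
  have Ac : A c by have := Aq 0%N; rewrite coefD coefMX coefC /= add0r.
  have Eq : E q.[x] by apply: gen_field_horner => // t; apply: AE.
  have Eq' : E q^`().[x] by apply: gen_field_deriv => // t; apply: AE.
  rewrite derivD derivM derivX derivC !hornerE dD ?dM ?jD ?jM //; last first.
  - exact: AE.
  - exact: gen_field_mul.
  - exact: gen_field_mul.
  rewrite (_ : _ - _ = j x * (del q.[x] - j q^`().[x] * del x) + del c); last by ring.
  by apply: TD; [apply: TM => //; apply: IHq|apply: AT].
have Ep' : E p^`().[x] by apply: gen_field_deriv => // t; apply: AE.
have p'x0 : p^`().[x] != 0.
  by move: sepp; rewrite separable_poly.unlock => /coprimep_root/(_ px).
have := key p Ap; rewrite (eqP px) der_on0 sub0r => /(submodN smT); rewrite opprK.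
move/(TM _ _ (gen_field_inv Ep')); rewrite hom_onV // mulrA mulVf ?mul1r //.
by rewrite hom_on_eq0.
Qed.

End Subfield.
End Partial.

Lemma hom_on_id (F : fieldType) (B : F -> Prop) : hom_on B id.
Proof. by []. Qed.

(** * Derivations on quotients of represented elements *)

Section Quotient.
Variables (A : comNzRingType) (C : fieldType) (ev : {rmorphism A -> C}).
Variables (P : A -> Prop) (D : A -> C).
Hypotheses (P1 : P 1) (PD : forall f g, P f -> P g -> P (f + g)).
Hypotheses (PN : forall f, P f -> P (- f)) (PM : forall f g, P f -> P g -> P (f * g)).
Hypothesis DD : forall f g, P f -> P g -> D (f + g) = D f + D g.
Hypothesis DM : forall f g, P f -> P g -> D (f * g) = D f * ev g + ev f * D g.
Hypothesis D_eq0 : forall f, P f -> ev f = 0 -> D f = 0.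

(** [P] is a subring of [A] representing elements of [C] through [ev]; [D_eq0] is what makes the
    quotient rule independent of representatives. *)
Definition quot_of (x : C) : Prop :=
  exists f g, [/\ P f, P g, ev g != 0 & x = ev f / ev g].

Lemma gen_field_quot (S : C -> Prop) :
  (forall x, S x -> exists2 f, P f & x = ev f) ->
  forall x, gen_field S x -> quot_of x.
Proof.
have P0 : P 0 by rewrite -(subrr 1); apply/PD/PN.
have Qev f : P f -> quot_of (ev f).
  by move=> Pf; exists f, 1; rewrite rmorph1 oner_eq0 divr1.
move=> SP x; elim=> {x} [x /SP[f Pf ->]||x y _ Qx _ Qy|x _ Qx|x y _ Qx _ Qy|x _ Qx].
- exact: Qev.
- by rewrite -(rmorph1 ev); apply: Qev.
- case: Qx Qy => f [g [Pf Pg g0 ->]] [f' [g' [Pf' Pg' g'0 ->]]].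
  exists (f * g' + f' * g), (g * g'); split; rewrite ?rmorphD ?rmorphM ?mulf_neq0 //; auto.
  by field; rewrite ?g0 ?g'0.
- case: Qx => f [g [Pf Pg g0 ->]]; exists (- f), g; split; rewrite ?rmorphN ?mulNr //; auto.
- case: Qx Qy => f [g [Pf Pg g0 ->]] [f' [g' [Pf' Pg' g'0 ->]]].
  exists (f * f'), (g * g'); split; rewrite ?rmorphM ?mulf_neq0 //; auto.
  by field; rewrite ?g0 ?g'0.
- case: Qx => f [g [Pf Pg g0 ->]]; have [e|f0] := eqVneq (ev f) 0.
    by exists 0, 1; rewrite rmorph1 oner_eq0 e rmorph0 !mul0r invr0.
  by exists g, f; rewrite invf_div.
Qed.

Definition quot_rule f g : C := (D f * ev g - ev f * D g) / ev g ^+ 2.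

(** Cross-multiplication puts [f * g' - f' * g] in the kernel of [ev]; the vanishing of [D] there is
    the required identity, up to denominators. *)
Lemma quot_rule_eq f g f' g' : P f -> P g -> P f' -> P g' ->
  ev g != 0 -> ev g' != 0 -> ev f / ev g = ev f' / ev g' ->
  quot_rule f g = quot_rule f' g'.
Proof.
move=> Pf Pg Pf' Pg' g0 g'0 /eqP; rewrite eqr_div // => /eqP e.
have: D (f * g' - f' * g) = 0.
  by apply: D_eq0; rewrite ?rmorphB ?rmorphM /= ?e ?subrr //; auto.
have DN h : P h -> D (- h) = - D h.
  move=> Ph; apply: (addrI (D h)); rewrite -DD ?subrr //; last exact: PN.
  by apply: D_eq0; rewrite ?rmorph0 // -(subrr 1); apply/PD/PN.
rewrite DD ?DN ?DM //; auto => e2.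
have {}e : ev f' = ev f * ev g' / ev g by rewrite e mulfK.
rewrite /quot_rule e; apply: (mulIf (expf_neq0 2 g0)); apply: (mulIf (expf_neq0 2 g'0)).
have {e2} -> : D f = (D f' * ev g + ev f' * D g - ev f * D g') / ev g'.
  apply: (mulIf g'0); rewrite mulfVK //; apply/eqP; rewrite -subr_eq0; apply/eqP.
  by rewrite -[RHS]e2; ring.
by rewrite e; field; rewrite ?g0 ?g'0.
Qed.

(** The quotient rule takes one value at each quotient, so choice turns it into a function. *)
Lemma quot_der : exists del : C -> C,
  der_on quot_of id del /\ (forall f, P f -> del (ev f) = D f).
Proof.
have: forall x, exists y, forall f g, P f -> P g -> ev g != 0 -> x = ev f / ev g ->
    y = quot_rule f g.
  move=> x; have [[f [g [Pf Pg g0 ->]]]|nQ] := pselect (quot_of x).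
    by exists (quot_rule f g) => f' g' *; apply: quot_rule_eq.
  by exists 0 => f g Pf Pg g0 e; case: nQ; exists f, g.
case/choice => del Hdel; exists del; split; last first.
  move=> f Pf; rewrite (Hdel _ f 1) ?rmorph1 ?oner_eq0 ?divr1 // /quot_rule rmorph1.
  have -> : D 1 = 0.
    have := DM P1 P1; rewrite mulr1 rmorph1 mulr1 mul1r => e.
    by apply: (addrI (D 1)); rewrite -e addr0.
  by rewrite mulr0 subr0 mulr1 expr1n divr1.
split=> x y [f [g [Pf Pg g0 ex]]] [f' [g' [Pf' Pg' g'0 ey]]].
- rewrite (Hdel x f g) // (Hdel y f' g') // (Hdel _ (f * g' + f' * g) (g * g')).
  + by rewrite /quot_rule !(DD, DM, rmorphD, rmorphM) /=; auto; field; rewrite ?g0 ?g'0.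
  + by auto.
  + by auto.
  + by rewrite rmorphM mulf_neq0.
  + by rewrite ex ey !(rmorphD, rmorphM) /=; field; rewrite ?g0 ?g'0.
- rewrite (Hdel x f g) // (Hdel y f' g') // (Hdel _ (f * f') (g * g')).
  + by rewrite ex ey /quot_rule !(DD, DM, rmorphD, rmorphM) /=; auto; field; rewrite ?g0 ?g'0.
  + by auto.
  + by auto.
  + by rewrite rmorphM mulf_neq0.
  + by rewrite ex ey !rmorphM /=; field; rewrite ?g0 ?g'0.
Qed.

End Quotient.

(** * Rational functions in arbitrarily many variables *)

Section Subfield.
Variables (L : fieldType) (S : L -> Prop).

(** A boolean form of [gen_field S], so that the subfield becomes a type of its own and can serve as
    a field of coefficients. *)
Definition in_gen_field : {pred L} := fun x => `[< gen_field S x >].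

Lemma in_gen_field_divring_closed : divring_closed in_gen_field.
Proof.
split=> [|x y /asboolP Sx /asboolP Sy|x y /asboolP Sx /asboolP Sy]; apply/asboolP.
- exact: gen_field_1.
- exact/gen_field_add/gen_field_opp.
- exact: gen_field_div.
Qed.

HB.instance Definition _ :=
  GRing.isDivringClosed.Build L in_gen_field in_gen_field_divring_closed.

Record subfld := Subfld { subfld_val :> L; _ : subfld_val \in in_gen_field }.
HB.instance Definition _ := [isSub for subfld_val].
HB.instance Definition _ := [Choice of subfld by <:].
HB.instance Definition _ := [SubChoice_isSubIntegralDomain of subfld by <:].
HB.instance Definition _ := [SubIntegralDomain_isSubField of subfld by <:].

Definition to_subfld (x : L) : subfld := insubd 0 x.

Lemma to_subfldK x : gen_field S x -> val (to_subfld x) = x.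
Proof. by move=> Sx; rewrite val_insubd ifT //; apply/asboolP. Qed.

Lemma subfldP (u : subfld) : gen_field S (val u).
Proof. by have /asboolP := valP u. Qed.

Lemma to_subfld_hom : [/\ to_subfld 1 = 1,
  (forall x y, gen_field S x -> gen_field S y ->
     to_subfld (x + y) = to_subfld x + to_subfld y)
  & (forall x y, gen_field S x -> gen_field S y ->
     to_subfld (x * y) = to_subfld x * to_subfld y)].
Proof.
split=> [|x y Sx Sy|x y Sx Sy]; apply: val_inj.
- by rewrite to_subfldK ?rmorph1 //; apply: gen_field_1.
- by rewrite rmorphD /= !to_subfldK //; apply: gen_field_add.
- by rewrite rmorphM /= !to_subfldK //; apply: gen_field_mul.
Qed.

End Subfield.

Lemma fraction_quot (R : idomainType) (x : {fraction R}) :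
  exists f g : R, g != 0 /\ x = FracField.tofrac f / FracField.tofrac g.
Proof.
elim/quotW: x => r; exists (\n_r), (\d_r); have d0 := denom_ratioP r; split=> //.
have d0' : FracField.tofrac (\d_r) != 0 :> {fraction R} by rewrite tofrac_eq0.
apply: (mulIf d0'); rewrite divfK //; unlock FracField.tofrac.
rewrite -[LHS]FracField.pi_mul /FracField.mulf; apply/eqmodP.
by rewrite /= FracField.equivfE !numden_Ratio ?(oner_eq0, mulf_neq0) ?mulr1 // mulrC.
Qed.

Definition all_gens (L M : fieldType) (V : Type) (S : L -> Prop) (phi : L -> M) (t : V -> M)
    (z : M) : Prop :=
  (exists2 c, gen_field S c & z = phi c) \/ exists v, z = t v.

(* [monalg] shadows the notations of [mpoly], so its import is confined here. *)
Module InfinitePolynomials.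
Import finmap monalg.
Local Open Scope fset_scope.
Local Open Scope ring_scope.

(** * Polynomials over an arbitrary set of variables *)

Section Polynomials.
Variables (F : fieldType) (V : choiceType).

(** The monoid algebra on finitely supported exponents, which admits the infinite set of indices as
    variables. *)
Definition ipoly := {malg F[{cmonom V}]}.
HB.instance Definition _ := GRing.ComNzRing.on ipoly.

(* Only the finitely many variables in [s] survive. *)
Section Restrict.
Variable s : seq V.
Let n := size s.

Definition restrict_cm (k : {cmonom V}) : mpoly.multinom n :=
  mpoly.Multinom [tuple k (tnth (in_tuple s) i) | i < n].

Definition restrict_mon (k : {cmonom V}) : mpoly.mpoly n F :=
  mpoly.mpolyX F (restrict_cm k).

Lemma restrict_mon_mmorphism : mmorphism restrict_mon.
Proof.
split=> [k k'|].
  rewrite /restrict_mon -mpoly.mpolyXD; congr mpoly.mpolyX; apply/mpoly.mnmP => i.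
  by rewrite mpoly.mnmDE !mpoly.multinomE !tnth_mktuple cmM.
rewrite /restrict_mon -(mpoly.mpolyX0 n F); congr mpoly.mpolyX; apply/mpoly.mnmP => i.
by rewrite mpoly.mnm0E mpoly.multinomE tnth_mktuple cm1.
Qed.

HB.instance Definition _ := isMultiplicative.Build _ _ restrict_mon restrict_mon_mmorphism.

Definition restrict (f : ipoly) : mpoly.mpoly n F :=
  mmap (@mpoly.mpolyC n F) restrict_mon f.

Lemma restrictM f g : restrict (f * g) = restrict f * restrict g.
Proof. exact: rmorphM. Qed.

(** When [s] contains all variables of [f], distinct monomials of [f] stay distinct, so each
    coefficient of [f] is a coefficient of [restrict s f]. *)
Lemma restrict_eq0 (f : ipoly) : (forall k, k \in msupp f -> {subset finsupp k <= s}) ->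
  restrict f = 0 -> f = 0.
Proof.
move=> fs f0; apply/malgP => k; rewrite mcoeff0; case: (boolP (k \in msupp f)) => kf; last first.
  exact: mcoeff_outdom.
have := congr1 (mpoly.mcoeff (restrict_cm k)) f0.
rewrite mpoly.mcoeff0 /restrict mmapE raddf_sum (big_fsetD1 k) //= big1_fset ?addr0.
  by rewrite mpoly.mcoeffCM mpoly.mcoeffX eqxx mulr1.
move=> k' /fsetD1P[k'k k'f] _; rewrite mpoly.mcoeffCM mpoly.mcoeffX.
case: eqP => [e|_]; last by rewrite mulr0.
case/eqP: k'k; apply/eqP/cmP => v.
have [vs|vs] := boolP (v \in s).
  have vs' : (index v s < n)%N by rewrite index_mem.
  have := congr1 (fun u : mpoly.multinom n => u (Ordinal vs')) e.
  by rewrite !mpoly.multinomE !tnth_mktuple (tnth_nth v) /= nth_index.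
have nz (l : {cmonom V}) : l \in msupp f -> l v = 0%N.
  by move=> lf; apply/eqP; rewrite cmE_eq0; apply: contra vs => /(fs l lf).
by rewrite !nz.
Qed.

End Restrict.

(** Together [f] and [g] involve a finite set [s] of variables, and restriction to [s] lands in a
    polynomial ring known to be a domain. *)
Lemma ipoly_idomain : forall f g : ipoly, f * g = 0 -> (f == 0) || (g == 0).
Proof.
move=> f g fg0.
pose s := flatten [seq (finsupp (k : {cmonom V}) : seq V) | k <- msupp f ++ msupp g].
have sub k : k \in msupp f ++ msupp g -> {subset finsupp k <= s}.
  by move=> kfg v vk; apply/flattenP; exists (finsupp k : seq V) => //; apply: map_f.
have := restrictM s f g; rewrite fg0 /restrict raddf0 => /esym/eqP; rewrite mulf_eq0.
by case/orP=> /eqP/restrict_eq0 e; apply/orP; [left|right]; apply/eqP/e => k kf;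
  apply: sub; rewrite mem_cat kf ?orbT.
Qed.

Definition ipoly_unit : pred ipoly := fun f => `[< exists g, g * f = 1 >].

Lemma ipoly_inv_ex (f : ipoly) :
  exists g, if ipoly_unit f then g * f = 1 else g = f.
Proof. by rewrite /ipoly_unit; case: asboolP => [//|_]; exists f. Qed.

Definition ipoly_inv : ipoly -> ipoly := projT1 (choice ipoly_inv_ex).

Lemma ipoly_invE f : if ipoly_unit f then ipoly_inv f * f = 1 else ipoly_inv f = f.
Proof. exact: (projT2 (choice ipoly_inv_ex) f). Qed.

Lemma ipoly_mulVf : {in ipoly_unit, left_inverse 1 ipoly_inv *%R}.
Proof. by move=> f fu; have := ipoly_invE f; rewrite [ipoly_unit f]fu. Qed.

Lemma ipoly_unitP (f g : ipoly) : g * f = 1 -> ipoly_unit f.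
Proof. by move=> gf; apply/asboolP; exists g. Qed.

Lemma ipoly_inv_out : {in [predC ipoly_unit], ipoly_inv =1 id}.
Proof. by move=> f /negbTE fu; have := ipoly_invE f; rewrite [ipoly_unit f]fu. Qed.

HB.instance Definition _ :=
  GRing.ComNzRing_hasMulInverse.Build ipoly ipoly_mulVf ipoly_unitP ipoly_inv_out.
HB.instance Definition _ := GRing.ComUnitRing_isIntegral.Build ipoly ipoly_idomain.

(* Keeping the fraction field abstract stops unification from unfolding it. *)
Section Fractions.
Variables (ratfun : fieldType) (rf_of : {rmorphism ipoly -> ratfun}).
Hypothesis rf_of_inj : forall f, rf_of f = 0 -> f = 0.
Hypothesis rf_of_quot : forall x, exists f g, g != 0 /\ x = rf_of f / rf_of g.

Definition rf_const (c : F) : ratfun := rf_of (malgC c).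
HB.instance Definition _ := GRing.RMorphism.copy rf_const (rf_of \o (@malgC {cmonom V} F)).
Definition rf_mon (k : {cmonom V}) : ratfun := rf_of << k >>.
Definition rf_var (v : V) : ratfun := rf_mon (ucm v).

Lemma rf_monM k k' : rf_mon (mmul k k') = rf_mon k * rf_mon k'.
Proof.
have -> : rf_mon (mmul k k') = rf_of (<< k >> * << k' >>).
  by rewrite malgM_def fgmulUU mulr1.
exact: (rmorphM rf_of).
Qed.

Lemma rf_ofU c k : rf_of << c *g k >> = rf_const c * rf_mon k.
Proof.
have -> : << c *g k >> = malgC c * << k >> :> ipoly.
  by rewrite malgM_def fgmulUU mulr1 mul1m.
exact: (rmorphM rf_of).
Qed.

Lemma rf_of_sum (I : Type) (s : seq I) (G : I -> ipoly) :
  rf_of (\sum_(i <- s) G i) = \sum_(i <- s) rf_of (G i).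
Proof. exact: (raddf_sum rf_of). Qed.

(** Monomials are products of variables, by induction on the degree; polynomials and quotients
    follow. *)
Lemma ratfun_gen (x : ratfun) :
  gen_field (fun z => (exists c, z = rf_const c) \/ exists v, z = rf_var v) x.
Proof.
set G := gen_field _.
have Gmon k : G (rf_mon k).
  have [l] := ubnP (mdeg k); elim: l k => // l IHl k; rewrite ltnS => kl.
  have [->|k1] := eqVneq k (onecm V).
    rewrite (_ : rf_mon _ = rf_of 1) // rmorph1; exact: gen_field_1.
  have /fset0Pn[v vk] : finsupp k != fset0.
    apply: contra k1 => /eqP k0; rewrite -mdeg_eq0 mdegE k0 big_seq_fset0 //.
  have ek : k = mmul (ucm v) (divcm k (ucm v)).
    apply/eqP/cmP => i; rewrite cmM divcmE subnKC // ucmE; case: eqP => // <-.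
    by rewrite lt0n cmE_neq0.
  rewrite ek rf_monM; apply: gen_field_mul; first by apply: gen_field_S; right; exists v.
  by apply: IHl; apply: leq_trans kl; rewrite [in leqRHS]ek mdegM mdegU.
have Grf f : G (rf_of f).
  rewrite [f]monalgE rf_of_sum; apply: gen_field_sum => k _.
  rewrite (rf_ofU (monalg.mcoeff k f) k).
  apply: gen_field_mul; last exact: Gmon.
  by apply: gen_field_S; left; eexists.
have [f [g [_ ->]]] := rf_of_quot x.
by apply: gen_field_div; apply: Grf.
Qed.

(** * Derivations of the rational function field *)

Section Derivation.
Variables (del : F -> ratfun) (y : V -> ratfun).
Hypothesis delD : forall a b, del (a + b) = del a + del b.
Hypothesis delM : forall a b, del (a * b) = del a * rf_const b + rf_const a * del b.

(** What the Leibniz rule gives for the monomial [k] when each variable [v] has derivative [y v]. *)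
Definition der_mon (k : {cmonom V}) : ratfun :=
  \sum_(v <- finsupp k) (k v)%:R * (rf_mon (divcm k (ucm v)) * y v).

Lemma der_monE (d : {fset V}) (k : {cmonom V}) : finsupp k `<=` d ->
  der_mon k = \sum_(v <- d) (k v)%:R * (rf_mon (divcm k (ucm v)) * y v).
Proof.
move=> kd; apply: big_fset_incl => // v _; rewrite -cmE_eq0 => /eqP ->.
by rewrite mul0r.
Qed.

Let leibniz_alg (a b A B B' u u' z : ratfun) : a * A = a * B * u' -> b * A = b * B' * u ->
  (a + b) * (A * z) = a * (B * z) * u' + u * (b * (B' * z)).
Proof. by move=> e1 e2; rewrite mulrDl !mulrA e1 e2; ring. Qed.

Let leibniz_alg2 (a a' b b' u u' z z' : ratfun) :
  (a * b' + b * a') * (u * u') + b * b' * (z * u' + u * z') =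
  (a * u + b * z) * (b' * u') + b * u * (a' * u' + b' * z').
Proof. by ring. Qed.

Lemma der_monM k k' : der_mon (mmul k k') = der_mon k * rf_mon k' + rf_mon k * der_mon k'.
Proof.
rewrite (der_monE (d := finsupp k `|` finsupp k')) ?mdomD //.
rewrite (der_monE (fsubsetUl _ (finsupp k'))) (der_monE (fsubsetUr (finsupp k) _)).
rewrite [X in _ = X + _]mulr_suml.
rewrite [X in _ = _ + X]mulr_sumr.
rewrite -[RHS]big_split /=.
apply: eq_bigr => v _.
have div_mul (l l' : {cmonom V}) : (l v)%:R * rf_mon (divcm (mmul l l') (ucm v)) =
    (l v)%:R * rf_mon (divcm l (ucm v)) * rf_mon l'.
  have [->|lv] := posnP (l v); first by rewrite mulr0n [LHS]mul0r [X in _ = X * _]mul0r mul0r.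
  rewrite -mulrA -rf_monM; congr (_ * rf_mon _); apply/eqP/cmP => i.
  by rewrite cmM !divcmE cmM ucmE; case: eqP => [<-|_]; lia.
have e1 := div_mul k k'; have e2 := div_mul k' k; rewrite (mulmC k' k) in e2.
rewrite cmM natrD; exact: leibniz_alg e1 e2.
Qed.

Lemma ratfun_der : exists D : ratfun -> ratfun,
  [/\ der_on (fun=> True) id D, (forall c, D (rf_const c) = del c)
    & (forall v, D (rf_var v) = y v)].
Proof.
have dzm : zmod_morphism del.
  have del0 : del 0 = 0 by apply: (addrI (del 0)); rewrite -delD !addr0.
  have delN c : del (- c) = - del c by apply: (addrI (del c)); rewrite -delD !subrr.
  by move=> a b; rewrite delD delN.
pose dA : {additive F -> ratfun} := HB.pack del (GRing.isZmodMorphism.Build _ _ del dzm).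
(* The first summand differentiates the coefficients, the second the monomials. *)
pose D (f : ipoly) : ratfun := mmap dA rf_mon f + mmap rf_const der_mon f.
have DD f g : D (f + g) = D f + D g.
  have e1 : mmap dA rf_mon (f + g) = mmap dA rf_mon f + mmap dA rf_mon g by exact: mmapD.
  have e2 : mmap rf_const der_mon (f + g) = mmap rf_const der_mon f + mmap rf_const der_mon g.
    exact: mmapD.
  by rewrite /D e1 e2 addrACA.
have D0 : D 0 = 0 by apply: (addrI (D 0)); rewrite -DD !addr0.
have DU c k : D << c *g k >> = del c * rf_mon k + rf_const c * der_mon k.
  by rewrite /D !mmapU.
have Dsum I (s : seq I) (G : I -> ipoly) : D (\sum_(i <- s) G i) = \sum_(i <- s) D (G i).
  by elim: s => [|i s IHs]; rewrite ?big_nil ?D0 // !big_cons DD IHs.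
have DUM c k c' k' : D (<< c *g k >> * << c' *g k' >>) =
    D << c *g k >> * rf_of << c' *g k' >> + rf_of << c *g k >> * D << c' *g k' >>.
  have -> : << c *g k >> * << c' *g k' >> = << c * c' *g mmul k k' >> :> ipoly.
    by rewrite malgM_def fgmulUU.
  pose bil (p q u v : ratfun) := p * q + u * v.
  apply: (etrans (DU _ _)).
  apply: (etrans (f_equal4 bil (delM c c') (rf_monM k k') (rmorphM rf_const c c') (der_monM k k'))).
  apply: (etrans _ (esym (f_equal4 bil (DU c k) (rf_ofU c' k') (rf_ofU c k) (DU c' k')))).
  exact: leibniz_alg2.
have DM f g : D (f * g) = D f * rf_of g + rf_of f * D g.
  (* Both sides of the product rule are biadditive, so the single terms treated in [DUM] suffice. *)
  have bilin (I J : Type) (s : seq I) (s' : seq J) (G : I -> ipoly) (H : J -> ipoly) :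
      (forall i j, D (G i * H j) = D (G i) * rf_of (H j) + rf_of (G i) * D (H j)) ->
      D ((\sum_(i <- s) G i) * (\sum_(j <- s') H j)) =
      D (\sum_(i <- s) G i) * rf_of (\sum_(j <- s') H j) +
      rf_of (\sum_(i <- s) G i) * D (\sum_(j <- s') H j).
    move=> DGH; rewrite mulr_suml !Dsum !rf_of_sum !mulr_suml -big_split /=.
    apply: eq_bigr => i _; rewrite !mulr_sumr Dsum -big_split /=.
    by apply: eq_bigr => j _; apply: DGH.
  have := bilin _ _ (msupp f) (msupp g) (fun k => << monalg.mcoeff k f *g k >>)
    (fun k => << monalg.mcoeff k g *g k >>) (fun k k' => DUM _ k _ k').
  by rewrite -!monalgE.
have D_eq0 f : True -> rf_of f = 0 -> D f = 0 by move=> _ /rf_of_inj ->.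
have [D' [derD' D'E]] := @quot_der ipoly ratfun rf_of (fun=> True) D I (fun _ _ _ _ => I)
  (fun _ _ => I) (fun _ _ _ _ => I) (fun f g _ _ => DD f g) (fun f g _ _ => DM f g) D_eq0.
exists D'; split.
- apply: der_onS derD' => x _; have [f [g [g0 ->]]] := rf_of_quot x.
  by exists f, g; split=> //; apply: contra g0 => /eqP/rf_of_inj ->.
- move=> c; rewrite /rf_const D'E // DU /der_mon mdom1 big_seq_fset0 mulr0 addr0.
  by rewrite (_ : rf_mon _ = rf_of 1) // (rmorph1 rf_of) mulr1.
- move=> v; rewrite /rf_var /rf_mon D'E // DU.
  have -> : del 1 = 0.
    by apply: (addrI (del 1)); have := delM 1 1;
      rewrite (rmorph1 rf_const) !mulr1 mul1r addr0 => <-.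
  rewrite (rmorph1 rf_const) mul0r mul1r add0r /der_mon mdomU big_seq_fset1 cmUU mul1r.
  have -> : divcm (ucm v) (ucm v) = onecm V.
    by apply/eqP/cmP => i; rewrite divcmE subnn onecmE.
  by rewrite (_ : rf_mon _ = rf_of 1) // (rmorph1 rf_of) mul1r.
Qed.

End Derivation.
End Fractions.
End Polynomials.

(* [M] is the field of rational functions in the variables [t v] over the
   subfield generated by [S], embedded by [phi]. *)
Lemma free_extension (L : fieldType) (S : L -> Prop) (V : choiceType) :
  exists (M : fieldType) (phi : L -> M) (t : V -> M),
  [/\ hom_on (gen_field S) phi,
      (forall x, gen_field (all_gens S phi t) x)
    & (forall (del : L -> M) (y : V -> M), der_on (gen_field S) phi del ->
       exists D : M -> M, [/\ der_on (fun=> True) id D,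
         (forall c, gen_field S c -> D (phi c) = del c) & (forall v, D (t v) = y v)])].
Proof.
pose F : fieldType := subfld S.
pose R : idomainType := ipoly F V.
have : exists (M : fieldType) (rf : {rmorphism R -> M}), (forall f, rf f = 0 -> f = 0) /\
    forall x, exists f g, g != 0 /\ x = rf f / rf g.
  exists {fraction R}, (@FracField.tofrac R); split=> [f /eqP|x].
    by rewrite tofrac_eq0 => /eqP.
  exact: fraction_quot.
move=> [M [rf [rf_inj rf_quot]]].
pose const : {rmorphism F -> M} := rf_const rf.
pose phi x := const (to_subfld S x).
have [h1 hD hM] := to_subfld_hom S.
have phiE (c : F) : phi (val c) = const c.
  apply: (congr1 const); apply: val_inj; rewrite to_subfldK //; apply: subfldP.
exists M, phi, (rf_var rf).
split.
- rewrite /phi; split=> [|x y Sx Sy|x y Sx Sy]; first by rewrite h1 rmorph1.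
    by rewrite hD // rmorphD.
  by rewrite hM // rmorphM.
- move=> x; apply: gen_field_trans (ratfun_gen rf_quot x) => y.
  move=> [[c ->]|[v ->]]; apply: gen_field_S; [left|by right; exists v].
  by exists (val c); [apply: subfldP|rewrite phiE].
- move=> del y [dD dM].
  have delD (a b : F) : (del \o val) (a + b) = (del \o val) a + (del \o val) b.
    exact: etrans (dD _ _ (subfldP a) (subfldP b)).
  have delM (a b : F) : (del \o val) (a * b) =
      (del \o val) a * rf_const rf b + rf_const rf a * (del \o val) b.
    by apply: etrans (dM _ _ (subfldP a) (subfldP b)) _; rewrite !phiE.
  have [D [derD Dc Dt]] := ratfun_der rf_inj rf_quot y delD delM.
  exists D; split=> // c Sc; apply: (etrans (Dc _)).
  by rewrite /= to_subfldK.
Qed.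

End InfinitePolynomials.

(** * The order on indices *)

Section LexOrder.
Implicit Types s t u : seq nat.

Lemma lexle_refl s : lexle s s.
Proof. by elim: s => //= x s ->; rewrite eqxx orbT. Qed.

Lemma lexle_trans s t u : size s = size t -> lexle s t -> lexle t u -> lexle s u.
Proof.
elim: s t u => [|x s IHs] [|y t] [|z u] //= [est].
move=> /orP[xy|/andP[/eqP-> st]] /orP[yz|/andP[/eqP<- tu]].
- by rewrite (ltn_trans xy yz).
- by rewrite xy.
- by rewrite yz.
- by rewrite eqxx (IHs t) // orbT.
Qed.

Lemma lexle_anti s t : size s = size t -> lexle s t -> lexle t s -> s = t.
Proof.
elim: s t => [|x s IHs] [|y t] //= [est].
move=> /orP[xy|/andP[/eqP-> st]] /orP[yz|/andP[e ts]].
- by have := ltn_trans xy yz; rewrite ltnn.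
- by rewrite (eqP e) ltnn in xy.
- by rewrite ltnn in yz.
- by rewrite (IHs t).
Qed.

Lemma lexle_total s t : lexle s t || lexle t s.
Proof.
elim: s t => [|x s IHs] [|y t] //=.
by case: (ltngtP x y) => //= _; apply: IHs.
Qed.

Lemma lexle_addr (I : Type) (s : seq I) (f g h : I -> nat) :
  lexle [seq (f i + h i)%N | i <- s] [seq (g i + h i)%N | i <- s] =
  lexle (map f s) (map g s).
Proof. by elim: s => //= i s ->; rewrite ltn_add2r eqn_add2r. Qed.

End LexOrder.

Section TriOrder.
Variables (m n : nat).
Local Notation T := ('X_{1..m} * 'I_n)%type.
Implicit Types v w u : T.

(** The index of the [i]-th derivative of the generator indexed by [v]. *)
Definition sh (i : 'I_m) v : T := ((v.1 + U_(i))%MM, v.2).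

Lemma mdeg_sh i v : mdeg (sh i v).1 = (mdeg v.1).+1.
Proof. by rewrite mdegD mdeg1 addn1. Qed.

Lemma shC i j v : sh i (sh j v) = sh j (sh i v).
Proof. by rewrite /sh /= -!addmA [(U_(j) + _)%MM]addmC. Qed.

Lemma sh_inj i : injective (sh i).
Proof. move=> [x k] [y h] e; have /= ek := congr1 snd e; have /= ex := congr1 fst e.
by rewrite ek (addIm ex). Qed.

Lemma size_tri_key v w : size (tri_key v) = size (tri_key w).
Proof. by rewrite /= !size_map. Qed.

(** The key omits the last exponent, which the degree recovers. *)
Lemma tri_key_inj : injective (@tri_key m n).
Proof.
move=> [x k] [y h] [ed /val_inj -> e]; congr (_, _).
have exy (i : 'I_m) : (i < m.-1)%N -> x i = y i.
  by move/eq_in_map: e => /(_ i) e im; apply: e; rewrite mem_filter im mem_enum.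
apply/mnmP => i; case: (ltnP i m.-1) => im; first exact: exy.
move: ed; rewrite !mdegE (bigD1 i) //= [in RHS](bigD1 i) //=.
rewrite (eq_bigr y); first by move/addIn.
move=> j; rewrite -val_eqE => ji; apply: exy.
by have := ltn_ord j; have := ltn_ord i; move: ji => /=; lia.
Qed.

Lemma tri_lt_irr v : tri_lt v v = false.
Proof. by rewrite /tri_lt eqxx andbF. Qed.

Lemma tri_le_trans v w u : tri_le v w -> tri_le w u -> tri_le v u.
Proof. exact: lexle_trans (size_tri_key _ _). Qed.

Lemma tri_le_eqVlt v w : tri_le v w = (v == w) || tri_lt v w.
Proof.
rewrite /tri_lt; case: eqVneq => [->|_]; last by rewrite andbT.
by rewrite [tri_le _ _]lexle_refl.
Qed.

Lemma tri_le_lt_trans v w u : tri_le v w -> tri_lt w u -> tri_lt v u.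
Proof.
move=> vw /andP[wu wu']; rewrite /tri_lt (tri_le_trans vw wu) /=.
apply: contra_neq wu' => e; apply: tri_key_inj; apply: lexle_anti (size_tri_key _ _) wu _.
by rewrite -e.
Qed.

Lemma tri_lt_trans v w u : tri_lt v w -> tri_lt w u -> tri_lt v u.
Proof. by move=> /andP[vw _]; apply: tri_le_lt_trans. Qed.

Lemma tri_lt_total v w : v != w -> tri_lt v w || tri_lt w v.
Proof. by move=> vw; rewrite /tri_lt [w == v]eq_sym vw !andbT; apply: lexle_total. Qed.

Lemma tri_lt_mdeg v w : (mdeg v.1 < mdeg w.1)%N -> tri_lt v w.
Proof.
move=> vw; rewrite /tri_lt /tri_le /= vw /=; apply: contraTneq vw => ->.
by rewrite ltnn.
Qed.

Lemma tri_lt_mdegW v w : tri_lt v w -> (mdeg v.1 <= mdeg w.1)%N.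
Proof. by case/andP=> /=/orP[/ltnW//|/andP[/eqP->]]. Qed.

Lemma tri_lt_sh_self i v : tri_lt v (sh i v).
Proof. by apply: tri_lt_mdeg; rewrite mdeg_sh. Qed.

(** A shift adds the same amount to corresponding entries of both keys; thus differentiation
    preserves the order of generators. *)
Lemma tri_le_sh i v w : tri_le (sh i v) (sh i w) = tri_le v w.
Proof.
rewrite /tri_le /tri_key !mdeg_sh /= ltnS eqSS.
congr (_ || _ && (_ || _ && _)).
rewrite -[RHS](lexle_addr _ _ _ (fun j => U_(i)%MM j)).
by congr lexle; apply: eq_map => j; rewrite mnmDE.
Qed.

Lemma tri_lt_sh i v w : tri_lt (sh i v) (sh i w) = tri_lt v w.
Proof. by rewrite /tri_lt tri_le_sh (inj_eq (@sh_inj i)). Qed.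

Definition upto (d : nat) : seq T :=
  [seq (bmnm w.1, w.2) | w : 'X_{1..m < d.+1} * 'I_n].

Lemma mem_upto d v : (mdeg v.1 <= d)%N -> v \in upto d.
Proof.
move=> vd; apply/mapP; exists (BMultinom (n := m) (bound := d.+1) (bmnm := v.1) vd, v.2) => //.
  by rewrite mem_enum.
by case: v vd.
Qed.

Lemma upto_uniq d : uniq (upto d).
Proof.
by rewrite map_inj_uniq ?enum_uniq // => -[x k] [y h] [/val_inj -> ->].
Qed.

(** The number of predecessors, finite because none has larger degree: a measure for induction, and
    later the fuel of a recursion. *)
Definition tri_rank v := count (fun w => tri_lt w v) (upto (mdeg v.1)).

Lemma tri_rank_lt v w : tri_lt v w -> (tri_rank v < tri_rank w)%N.
Proof.
move=> vw; rewrite /tri_rank -!size_filter.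
set s := filter _ _; set t := filter _ _.
rewrite -[_.+1]/(size (v :: s)); apply: uniq_leq_size.
  by rewrite /= mem_filter tri_lt_irr filter_uniq // upto_uniq.
move=> u; rewrite inE !mem_filter => /orP[/eqP->|/andP[uv _]].
  by rewrite vw mem_upto // tri_lt_mdegW.
by have uw := tri_lt_trans uv vw; rewrite uw mem_upto // tri_lt_mdegW.
Qed.

Lemma tri_ind (P : T -> Prop) :
  (forall v, (forall w, tri_lt w v -> P w) -> P v) -> forall v, P v.
Proof.
move=> IH v; have [k] := ubnP (tri_rank v); elim: k v => // k IHk v; rewrite ltnS => vk.
by apply: IH => w /tri_rank_lt wv; apply: IHk; apply: leq_trans wv vk.
Qed.

End TriOrder.

(** * The derivations given by the differential condition *)

Section MmapDerivation.
Variables (n : nat) (K L : fieldType) (f : {rmorphism K -> L}) (g : {additive K -> L}).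
Variable h : 'I_n -> L.
Hypothesis gM : forall x y, g (x * y) = g x * f y + f x * g y.

Lemma mmap_scaleX c mon : mmap g h (c *: 'X_[mon]) = g c * mmap1 h mon.
Proof.
have [->|c0] := eqVneq c 0; first by rewrite scale0r !raddf0 mul0r.
rewrite /mmap (perm_big _ (msuppZ _ c0)) /= msuppX big_seq1.
by rewrite mcoeffZ mcoeffX eqxx mulr1.
Qed.

(** With [g] the composite of [iota] and [d i], this is the product rule for differentiating
    coefficients. Additivity in [p] and [q] reduces it to single terms. *)
Lemma mmap_leibniz p q :
  mmap g h (p * q) = mmap g h p * mmap f h q + mmap f h p * mmap g h q.
Proof.
rewrite [p]mpolyE; elim/big_rec: _ => [|mon p' _ IHp].
  by rewrite mul0r !raddf0 !mul0r addr0.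
rewrite mulrDl !mmapD IHp !mulrDl.
suff -> : mmap g h (p@_mon *: 'X_[mon] * q) = mmap g h (p@_mon *: 'X_[mon]) * mmap f h q
   + mmap f h (p@_mon *: 'X_[mon]) * mmap g h q by rewrite addrACA.
move: (p@_mon) => c {p p' IHp}.
rewrite [q]mpolyE; elim/big_rec: _ => [|mon' q' _ IHq].
  by rewrite mulr0 !raddf0 !mulr0 addr0.
rewrite mulrDr !mmapD IHq !mulrDr.
suff -> : mmap g h (c *: 'X_[mon] * (q@_mon' *: 'X_[mon'])) =
   mmap g h (c *: 'X_[mon]) * mmap f h (q@_mon' *: 'X_[mon'])
   + mmap f h (c *: 'X_[mon]) * mmap g h (q@_mon' *: 'X_[mon']) by rewrite addrACA.
rewrite -scalerAl -scalerAr scalerA -mpolyXD !mmap_scaleX !mmapZ !mmapX gM.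
rewrite commr_mmap1_M; last by move=> *; apply: mulrC.
by rewrite mulrDl; congr (_ + _); rewrite -!mulrA; congr (_ * _); rewrite mulrCA.
Qed.

End MmapDerivation.

Section Extension.
Variables (m : nat) (K : fieldType) (d : 'I_m -> K -> K).
Variables (n r : nat) (L : fieldType) (iota : {rmorphism K -> L}).
Variable a : 'X_{1..m} -> 'I_n -> L.
Hypotheses (n0 : (0 < n)%N) (r0 : (0 < r)%N).
Hypothesis dcomm : commuting_derivations d.

Local Notation T := ('X_{1..m} * 'I_n)%type.
Local Notation E := (field_lt2r r iota a).
Local Notation av v := (a v.1 v.2).
Implicit Types v w u : T.

Lemma E_iota c : E (iota c).
Proof. by apply: gen_field_S; left; exists c. Qed.

Lemma E_av v : (mdeg v.1 < 2 * r)%N -> E (av v).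
Proof. by case: v => x k v2r; apply: gen_field_S; right; exists x, k. Qed.

Lemma E_ind (P : L -> Prop) : (forall c, P (iota c)) ->
  (forall v, (mdeg v.1 < 2 * r)%N -> P (av v)) ->
  forall x, (exists c, x = iota c) \/ (exists xi h, (mdeg xi < 2 * r)%N /\ x = a xi h) -> P x.
Proof.
move=> Pc Pa x [[c ->]|[xi [h [xi2r ->]]]]; first exact: Pc.
exact: (Pa (xi, h)).
Qed.

(** The indices up to [v0] are exactly those of level below [2 * r], so the differential condition
    at [v0] alone governs all of [E]. *)
Lemma tri_max_lt2r : exists v0 : T, (mdeg v0.1 < 2 * r)%N /\
  forall v, (mdeg v.1 < 2 * r)%N -> tri_le v v0.
Proof.
have m0 : (mdeg (0%MM : 'X_{1..m}) < 2 * r)%N by rewrite mdeg0 muln_gt0.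
pose w0 : 'X_{1..m < 2 * r} * 'I_n := (BMultinom m0, Ordinal n0).
have [[w k] _ wmax] := @arg_maxnP _ w0 xpredT (fun z => tri_rank (bmnm z.1, z.2)) isT.
exists (bmnm w, k); split=> [|v v2r]; first exact: (bmdeg w).
rewrite tri_le_eqVlt; case: eqVneq => //= vw.
have /orP[//|/tri_rank_lt lt_wv] := tri_lt_total vw.
have := wmax (BMultinom v2r, v.2) isT; rewrite /= leqNgt => /negP[].
by case: v v2r lt_wv {vw}.
Qed.

(** Elements of [E] are quotients of polynomials evaluated at [a]; the differential condition says
    that [D] vanishes on relations, so the quotient rule is well defined. *)
Lemma del_exists (i : 'I_m) : differential_condition r iota a d ->
  exists del : L -> L, [/\ der_on E id del, (forall c, del (iota c) = iota (d i c))
    & (forall v, (mdeg v.1 < 2 * r)%N -> del (av v) = av (sh i v))].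
Proof.
move=> dc; have [v0 [v02r v0max]] := tri_max_lt2r.
have [dD dM] := dcomm.1 i.
have dzm : zmod_morphism (iota \o d i).
  have d0 : d i 0 = 0 by apply: (addrI (d i 0)); rewrite -dD !addr0.
  have dN c : d i (- c) = - d i c by apply: (addrI (d i c)); rewrite -dD !subrr.
  by move=> x y /=; rewrite dD dN rmorphB.
pose dA : {additive K -> L} := HB.pack (iota \o d i)
  (GRing.isZmodMorphism.Build _ _ (iota \o d i) dzm).
pose N := @nvars m n r.
pose vr (j : 'I_N) := @var_of m n r j.
pose pt (j : 'I_N) := @apoint m n r L a j.
pose ev : {rmorphism {mpoly K[N]} -> L} := mmap iota pt.
pose P (f : {mpoly K[N]}) := poly_in_vars_le v0.1 v0.2 f.
(* The left side of the differential condition, as a function of [f]. *)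
pose D (f : {mpoly K[N]}) :=
  \sum_(j < N | tri_le (vr j) v0) ev f^`M(j) * av (sh i (vr j)) + mmap dA pt f.
have D_eq0 f : P f -> ev f = 0 -> D f = 0.
  move=> Pf f0; have v02r' : (mdeg v0.1 + 1 <= 2 * r)%N by rewrite addn1.
  have := dc i v0.2 v0.1 v02r' f Pf f0; rewrite /D; case: (v0) => x k /=.
  exact.
have DD f g : D (f + g) = D f + D g.
  rewrite /D mmapD addrACA -big_split /=; congr (_ + _); apply: eq_bigr => j _.
  by rewrite mderivD rmorphD mulrDl.
have DM f g : D (f * g) = D f * ev g + ev f * D g.
  rewrite /D (@mmap_leibniz _ _ _ iota dA); last first.
    by move=> x y; rewrite /= dM rmorphD !rmorphM.
  rewrite mulrDl mulrDr addrACA; congr (_ + _).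
  rewrite mulr_suml mulr_sumr -[RHS]big_split /=.
  apply: eq_bigr => j _; rewrite mderivM rmorphD !rmorphM /=; ring.
have PX j : (mdeg (vr j).1 < 2 * r)%N -> P 'X_j.
  move=> j2r mon; rewrite msuppX inE => /eqP -> j'; rewrite mnm1E.
  by case: eqP => // <- _; rewrite -surjective_pairing; apply: v0max.
have PC c : P c%:MP.
  move=> mon; rewrite msuppC; case: eqP => // _; rewrite inE => /eqP -> j.
  by rewrite mnm0E.
have PD f g : P f -> P g -> P (f + g).
  move=> Pf Pg mon /msuppD_le; rewrite mem_cat => /orP[]; [exact: Pf|exact: Pg].
have PN f : P f -> P (- f).
  by move=> Pf mon; rewrite (perm_mem (msuppN f)); apply: Pf.
have PM f g : P f -> P g -> P (f * g).
  move=> Pf Pg mon /msuppM_le /allpairsP[[m1 m2] /= [m1f m2g ->]] j.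
  by rewrite mnmDE addn_gt0 => /orP[]; [apply: Pf|apply: Pg].
have [del [derd delE]] := @quot_der _ _ ev P D (PC 1) PD PN PM (fun f g _ _ => DD f g)
  (fun f g _ _ => DM f g) D_eq0.
have evC c : ev c%:MP = iota c by rewrite /ev /= mmapC.
have vr_ex v : (mdeg v.1 < 2 * r)%N -> exists j, vr j = v.
  move=> v2r; have v2r' : (mdeg v.1 < (2 * r).+1)%N by rewrite ltnS ltnW.
  exists (enum_rank (BMultinom v2r', v.2)); rewrite /vr /var_of enum_rankK /=.
  by case: v {v2r v2r'}.
have evX j : ev 'X_j = av (vr j) by rewrite /ev /= mmapX mmap1U.
exists del; split.
- apply: der_onS derd => x; apply: gen_field_quot; try exact: (PC 1); try by [].
  apply: E_ind => [c|v v2r]; first by exists c%:MP; rewrite ?evC.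
  by have [j jv] := vr_ex v v2r; exists 'X_j; rewrite ?evX ?jv //; apply: PX; rewrite jv.
- move=> c; rewrite -evC delE // /D mmapC big1 ?add0r // => j _.
  by rewrite mderivC raddf0 mul0r.
- move=> v v2r; have [j jv] := vr_ex v v2r.
  rewrite -jv -evX delE; last by apply: PX; rewrite jv.
  rewrite /D; have -> : mmap dA pt 'X_j = 0.
    rewrite -[('X_j)]scale1r mmap_scaleX.
    suff -> : dA 1 = 0 by rewrite mul0r.
    rewrite /= (_ : d i 1 = 0) ?rmorph0 //; apply: (addrI (d i 1)).
    by have := dM 1 1; rewrite !mulr1 mul1r addr0 => <-.
  rewrite addr0 (bigD1 j) /=; last by apply: v0max; rewrite jv.
  rewrite big1 ?addr0 => [|j' /andP[_ j'j]].
    rewrite mderivX mnm1E eqxx /= scale1r.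
    have -> : (U_(j) - U_(j))%MM = 0%MM :> 'X_{1..N} by apply/mnmP => l; rewrite mnmBE subnn mnm0E.
    by rewrite mpolyX0 rmorph1 mul1r.
  by rewrite mderivX mnm1E eq_sym (negbTE j'j) scale0r rmorph0 mul0r.
Qed.

(** * Leaders *)

Hypothesis leaders_bounded : forall k : 'I_n,
  (forall x, min_sep_leader r iota a k x -> (mdeg x <= r)%N) \/
  (exists tau : 'X_{1..m}, mdeg tau = (2 * r)%N /\
     forall x, min_sep_leader r iota a k x -> (x <= tau)%MM).

Variable del : 'I_m -> L -> L.
Hypothesis del_der : forall i, der_on E id (del i).
Hypothesis del_iota : forall i c, del i (iota c) = iota (d i c).
Hypothesis del_av : forall i v, (mdeg v.1 < 2 * r)%N -> del i (av v) = av (sh i v).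

Local Notation FB v := (field_below r iota a v.1 v.2).
Local Notation SL v := (sep_leader r iota a v.2 v.1).

Lemma FB_iota v c : FB v (iota c).
Proof. by apply: gen_field_S; left; exists c. Qed.

Lemma FB_av w v : (mdeg w.1 <= 2 * r)%N -> tri_lt w v -> FB v (av w).
Proof.
case: w v => x k [y h] w2r wv; apply: gen_field_S; right; exists x, k; split=> //.
Qed.

Lemma FB_ind v (P : L -> Prop) : (forall c, P (iota c)) ->
  (forall w, (mdeg w.1 <= 2 * r)%N -> tri_lt w v -> P (av w)) ->
  forall x, (exists c, x = iota c) \/ (exists xi h,
    [/\ (mdeg xi <= 2 * r)%N, tri_lt (xi, h) (v.1, v.2) & x = a xi h]) -> P x.
Proof.
move=> Pc Pa x [[c ->]|[xi [h [xi2r lt ->]]]]; first exact: Pc.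
by apply: (Pa (xi, h)) => //; rewrite [v]surjective_pairing.
Qed.

Lemma FB_E v x : (mdeg v.1 < 2 * r)%N -> FB v x -> E x.
Proof.
move=> v2r; apply: gen_field_trans; apply: FB_ind => [c|w _ /tri_lt_mdegW wv].
  exact: E_iota.
by apply: E_av; apply: leq_ltn_trans v2r.
Qed.

Lemma E_FB v x : (mdeg v.1 = 2 * r)%N -> E x -> FB v x.
Proof.
move=> v2r; apply: gen_field_trans; apply: E_ind => [c|w w2r]; first exact: FB_iota.
by apply: FB_av; [apply: ltnW|apply: tri_lt_mdeg; rewrite v2r].
Qed.

Lemma FB_mono v w x : (mdeg v.1 <= 2 * r)%N -> tri_lt v w -> FB v x -> FB w x.
Proof.
move=> v2r vw; apply: gen_field_trans; apply: FB_ind => [c|u u2r uv].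
  exact: FB_iota.
by apply: FB_av => //; apply: tri_lt_trans vw.
Qed.

Lemma sep_alg_mem (S : L -> Prop) x : gen_field S x -> sep_alg_over (gen_field S) x.
Proof.
move=> Sx; exists ('X - x%:P); split.
- by rewrite polyXsubC_eq0.
- move=> t; rewrite coefB coefX coefC; apply: gen_field_add.
    by case: (t == 1%N); [apply: gen_field_1|apply: gen_field0].
  by apply: gen_field_opp; case: (t == 0%N) => //; apply: gen_field0.
- by rewrite root_XsubC.
- by rewrite separable_poly.unlock derivXsubC coprimep1.
Qed.

Lemma del_FB i v x : (mdeg v.1 < 2 * r)%N -> FB v x -> FB (sh i v) (del i x).
Proof.
move=> v2r; have v2r' := ltnW v2r; have v_sh := tri_lt_sh_self i v.
apply: (der_on_submod (j := id)) => //.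
- by apply: der_onS (del_der i) => y; apply: FB_E.
- split; first exact: gen_field0.
    exact: gen_field_add.
  by move=> b y Fb Fy; apply: gen_field_mul => //; apply: FB_mono Fb.
apply: FB_ind => [c|w w2r wv]; first by rewrite del_iota; apply: FB_iota.
have {}w2r : (mdeg w.1 < 2 * r)%N by apply: leq_ltn_trans (tri_lt_mdegW wv) v2r.
by rewrite del_av //; apply: FB_av; rewrite ?mdeg_sh // tri_lt_sh.
Qed.

(** Differentiating a separable equation for [av v] gives an equation of degree one for
    [av (sh i v)], over the field before it. *)
Lemma SL_sh i v : ((mdeg v.1).+1 < 2 * r)%N -> SL v -> SL (sh i v).
Proof.
move=> v2r [_ sepv]; have v2r' := ltnW v2r; have v_sh := tri_lt_sh_self i v.
have sh2r : (mdeg (sh i v).1 < 2 * r)%N by rewrite mdeg_sh.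
split; first exact: ltnW.
apply: sep_alg_mem; rewrite -(del_av i v2r').
apply: (der_on_sep (T := FB (sh i v)) (hom_on_id (FB (sh i v))) _ _ _ _ _ sepv).
- by apply: der_onS (del_der i) => y; apply: FB_E.
- by split; [apply: gen_field0|apply: gen_field_add|apply: gen_field_mul].
- by move=> c; apply: FB_mono => //; apply: ltnW.
- by move=> c; apply: del_FB.
- by apply: FB_av => //; apply: ltnW.
Qed.

(** * Linear relations at level [2 * r] *)

(* The [E]-span of [1] and the generators of level exactly [2 * r] satisfying [P]. *)
Definition lvl : seq T := [seq v <- upto m n (2 * r) | mdeg v.1 == (2 * r)%N].

Lemma mem_lvl v : mdeg v.1 = (2 * r)%N -> v \in lvl.
Proof. by move=> v2r; rewrite mem_filter v2r eqxx mem_upto ?v2r. Qed.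

Lemma lvl_mdeg v : v \in lvl -> mdeg v.1 = (2 * r)%N.
Proof. by rewrite mem_filter => /andP[/eqP]. Qed.

Lemma lvl_uniq : uniq lvl.
Proof. by rewrite filter_uniq ?upto_uniq. Qed.

Definition span (P : pred T) (x : L) : Prop := exists (c0 : L) (c : T -> L),
  [/\ E c0, (forall w, E (c w)) & x = c0 + \sum_(w <- lvl | P w) c w * av w].

Lemma span_E (P : pred T) x : E x -> span P x.
Proof.
move=> Ex; exists x, (fun=> 0); split=> //; first by move=> _; apply: gen_field0.
by rewrite big1 ?addr0 // => w _; rewrite mul0r.
Qed.

Lemma span_submod (P : pred T) : submod E id (span P).
Proof.
split; first by apply: span_E; apply: gen_field0.
  move=> _ _ [c0 [c [Ec0 Ec ->]]] [e0 [e [Ee0 Ee ->]]].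
  exists (c0 + e0), (fun w => c w + e w); split; first exact: gen_field_add.
    by move=> w; apply: gen_field_add; [apply: Ec|apply: Ee].
  by rewrite addrACA -big_split /=; congr (_ + _); apply: eq_bigr => w _; rewrite mulrDl.
move=> b _ Eb [c0 [c [Ec0 Ec ->]]].
exists (b * c0), (fun w => b * c w); split; first exact: gen_field_mul.
  by move=> w; apply: gen_field_mul => //; apply: Ec.
by rewrite mulrDr mulr_sumr; congr (_ + _); apply: eq_bigr => w _; rewrite mulrA.
Qed.

Lemma span_av (P : pred T) v : mdeg v.1 = (2 * r)%N -> P v -> span P (av v).
Proof.
move=> v2r Pv; exists 0, (fun w => (w == v)%:R); split; first exact: gen_field0.
  by move=> w; case: eqP => _; [apply: gen_field_1|apply: gen_field0].
rewrite add0r big_mkcond (bigD1_seq v) ?mem_lvl ?lvl_uniq //= Pv eqxx mul1r.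
by rewrite big1 ?addr0 // => w /negbTE ->; rewrite mul0r; case: ifP.
Qed.

Lemma span_sub (P : pred T) (Q : L -> Prop) : submod E id Q -> Q 1 ->
  (forall w, mdeg w.1 = (2 * r)%N -> P w -> Q (av w)) -> forall x, span P x -> Q x.
Proof.
move=> smQ Q1 Qav _ [c0 [c [Ec0 Ec ->]]]; have [Q0 QD QM] := smQ.
apply: (QD); first by rewrite -[c0]mulr1; apply: (QM).
rewrite big_seq_cond; apply: (big_ind Q Q0 QD) => w /andP[/lvl_mdeg w2r Pw].
by apply: QM => //; apply: Qav.
Qed.

(** The form that leadership takes at level [2 * r] when it comes from differentiating an equation
    over [E]. *)
Definition lin v : Prop := span (fun w => tri_lt w v) (av v).

(** As in [SL_sh], but derivatives of elements of [FB v] now reach level [2 * r], where they are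
    affine over [E] in the generators. *)
Lemma SL_lin i v : ((mdeg v.1).+1 = 2 * r)%N -> SL v -> lin (sh i v).
Proof.
move=> v2r [_ sepv]; have v2r' : (mdeg v.1 < 2 * r)%N by rewrite v2r.
rewrite /lin -del_av //.
apply: (der_on_sep (T := span (fun w => tri_lt w (sh i v))) (hom_on_id E) (del_der i) _ _ _ _ sepv).
- exact: span_submod.
- by move=> c; apply: FB_E.
- apply: (der_on_submod (j := id)) => //.
  + by apply: der_onS (del_der i) => y; apply: FB_E.
  + have [s0 sD sM] := span_submod (fun w => tri_lt w (sh i v)).
    by split=> // b x Fb; apply: sM; apply: FB_E Fb.
  + apply: FB_ind => [c|w w2r wv].
      by rewrite del_iota; apply: span_E; apply: E_iota.
    have {}w2r : (mdeg w.1 < 2 * r)%N by apply: leq_ltn_trans (tri_lt_mdegW wv) v2r'.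
    rewrite del_av //; move: (w2r); rewrite leq_eqVlt => /orP[/eqP e|w2r'].
      by apply: span_av; rewrite ?mdeg_sh // tri_lt_sh.
    by apply: span_E; apply: E_av; rewrite mdeg_sh.
- exact: E_av.
Qed.

Lemma lin_SL v : mdeg v.1 = (2 * r)%N -> lin v -> SL v.
Proof.
move=> v2r linv; split; first by rewrite v2r.
apply: sep_alg_mem; apply: (span_sub _ _ _ linv).
- split; [exact: gen_field0|exact: gen_field_add|].
  by move=> b x Eb; apply: gen_field_mul; apply: E_FB.
- exact: gen_field_1.
- by move=> w w2r wv; apply: FB_av; rewrite ?w2r.
Qed.

Lemma mnm_leE (x y : 'X_{1..m}) i : (x <= y)%MM -> (x i <= y i)%N.
Proof. by move/mnm_lepP. Qed.

Lemma mnm_lt_exists (x y : 'X_{1..m}) : (x <= y)%MM -> x != y -> exists i, (x i < y i)%N.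
Proof.
move=> /mnm_lepP xy nxy; apply: contrapT => nex; case/eqP: nxy; apply/mnmP => i.
apply/eqP; rewrite eqn_leq xy leqNgt /=; apply/negP => lt; apply: nex; by exists i.
Qed.

Lemma sh_sub i v : (0 < v.1 i)%N -> sh i ((v.1 - U_(i))%MM, v.2) = v.
Proof.
case: v => x k xi; congr (_, _); apply/mnmP => j; rewrite mnmDE mnmBE mnm1E.
by case: eqP => [<-|_]; rewrite ?subnK // subn0 addn0.
Qed.

Lemma mdeg_le (x y : 'X_{1..m}) : (x <= y)%MM -> (mdeg x <= mdeg y)%N.
Proof. by move=> /mnm_lepP xy; rewrite !mdegE; apply: leq_sum. Qed.

Lemma mdeg_lt (x y : 'X_{1..m}) : (x <= y)%MM -> x != y -> (mdeg x < mdeg y)%N.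
Proof.
move=> xy nxy; have [i xyi] := mnm_lt_exists xy nxy; have /mnm_lepP xy' := xy.
rewrite !mdegE (bigD1 i) //= [ltnRHS](bigD1 i) //= -addSn leq_add //.
by apply: leq_sum.
Qed.

(** Ascent from [x] to [y] by unit shifts: [SL_sh] below level [2 * r], [SL_lin] for the shift that
    reaches it. *)
Lemma SL_up (x y : 'X_{1..m}) k : SL (x, k) -> (x <= y)%MM ->
  ((mdeg y < 2 * r)%N -> SL (y, k)) /\ ((mdeg x < 2 * r)%N -> mdeg y = (2 * r)%N -> lin (y, k)).
Proof.
move=> SLx; have [e] := ubnP (mdeg y); elim: e y => // e IHe y; rewrite ltnS => ye xy.
have [exy|nxy] := eqVneq x y; first by rewrite -exy; split=> // x2r e2r; rewrite e2r ltnn in x2r.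
have [i xyi] := mnm_lt_exists xy nxy.
pose v : T := ((y - U_(i))%MM, k).
have ev : sh i v = (y, k) by apply: (@sh_sub i (y, k)); apply: leq_ltn_trans xyi.
have dv : mdeg y = (mdeg v.1).+1 by rewrite -(mdeg_sh i) ev.
have xv : (x <= v.1)%MM.
  apply/mnm_lepP => j; rewrite mnmBE mnm1E; move/mnm_lepP: xy => /(_ j).
  by case: eqP => [<- _|_]; rewrite ?subn0 // leq_subRL ?add1n //; apply: leq_ltn_trans xyi.
have ve : (mdeg v.1 < e)%N by rewrite -dv.
have [SLv _] := IHe _ ve xv; split=> [y2r|x2r y2r].
  by have := @SL_sh i v; rewrite ev -dv; apply=> //; apply: SLv; apply: ltnW; rewrite -dv.
by rewrite -ev; apply: SL_lin; rewrite -?dv //; apply: SLv; rewrite -dv y2r.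
Qed.

Lemma min_leader_exists k x : SL (x, k) -> exists2 y, min_sep_leader r iota a k y & (y <= x)%MM.
Proof.
have [e] := ubnP (mdeg x); elim: e x => // e IHe x; rewrite ltnS => xe SLx.
have [[y [yx nyx SLy]]|nex] := pselect (exists y, [/\ (y <= x)%MM, y != x & SL (y, k)]).
  have ye : (mdeg y < e)%N by apply: leq_trans (mdeg_lt yx nyx) xe.
  by have [z minz zy] := IHe y ye SLy; exists z => //; apply: lepm_trans yx.
exists x; last exact: lepm_refl.
by split=> // y yx nyx SLy; apply: nex; exists y.
Qed.

(** * Leaders at all levels *)

(* A minimal separable leader of level [2 * r] that is not linear is dropped:
   its value will be replaced by an indeterminate. *)
Definition kept k x : Prop :=
  min_sep_leader r iota a k x /\ ((mdeg x < 2 * r)%N \/ lin (x, k)).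

(** The upward closure of the kept minimal leaders, which extends the notion of leader beyond the
    given generators. *)
Definition Lead v : bool := `[< exists2 x, kept v.2 x & (x <= v.1)%MM >].

Lemma Lead_sh i v : Lead v -> Lead (sh i v).
Proof.
move=> /asboolP[x kx xv]; apply/asboolP; exists x => //.
by apply: lepm_trans xv _; apply: lem_addr.
Qed.

Lemma Lead_SL v : (mdeg v.1 < 2 * r)%N -> Lead v -> SL v.
Proof. by case: v => y k v2r /asboolP[x [[SLx _] _] xv]; apply: (SL_up SLx xv).1. Qed.

(** An index above a strictly lower leader is linear by [SL_up]; a minimal one is linear because
    [kept] demands it. Conversely, a linear index is a separable leader, and a minimal leader under
    it is kept. *)
Lemma Lead_lin v : mdeg v.1 = (2 * r)%N -> Lead v <-> lin v.
Proof.
case: v => y k /= y2r; split=> [/asboolP[x [[SLx _] /= lx] /= xy]|liny].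
  have [exy|nxy] := eqVneq x y; last first.
    by apply: (SL_up SLx xy).2 => //; rewrite -y2r; apply: mdeg_lt.
  by rewrite -exy; case: lx => //; rewrite exy y2r ltnn.
have [x minx xy] := min_leader_exists (@lin_SL (y, k) y2r liny).
apply/asboolP; exists x => //; split=> //.
have [->|nxy] := eqVneq x y; [by right|left].
by rewrite -y2r; apply: mdeg_lt.
Qed.

(** Meant for two routes [sh i u = sh l y] to one index: the directions agree, or both routes start
    at a common leader [x], where the two derivations can be interchanged. *)
Definition linked i u l y : Prop :=
  i = l \/ exists x, [/\ y = sh i x, u = sh l x & Lead x].

Lemma Lead_linked i j u w : sh i u = sh j w -> (2 * r < mdeg (sh i u).1)%N ->
  Lead u -> Lead w -> exists l y, [/\ sh l y = sh i u, linked i u l y & linked j w l y].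
Proof.
set z := sh i u => zw z2r /asboolP[p kp pu] /asboolP[q kq qw].
have ek : w.2 = u.2 by have := congr1 snd zw.
rewrite ek in kq; pose s := [multinom maxn (p e) (q e) | e < m].
have sE e : s e = maxn (p e) (q e) by rewrite multinomE tnth_mktuple.
have s2r : (mdeg s <= 2 * r)%N.
  (* The degree of the join [s] is at most the sum of those of [p] and [q] in the first case; in the
     second, [s] lies under [tau]. *)
  have [le_r|[tau [<- le_tau]]] := leaders_bounded u.2.
    apply: (@leq_trans (mdeg p + mdeg q)).
      rewrite !mdegE -big_split /=; apply: leq_sum => e _; rewrite sE; lia.
    by rewrite mul2n -addnn; apply: leq_add; apply: le_r; [case: kp|case: kq].
  apply: mdeg_le; apply/mnm_lepP => e; rewrite sE geq_max.
  by rewrite !mnm_leE //; apply: le_tau; [case: kq|case: kp].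
have zi e : z.1 e = (u.1 e + (i == e))%N by rewrite mnmDE mnm1E.
have zj e : z.1 e = (w.1 e + (j == e))%N by rewrite zw mnmDE mnm1E.
have sz : (s <= z.1)%MM.
  apply/mnm_lepP => e; rewrite sE geq_max {1}zi zj.
  by rewrite (leq_trans (mnm_leE e pu)) ?leq_addr // (leq_trans (mnm_leE e qw)) ?leq_addr.
(* The degree of [z] exceeds that of [s], so [z] can be lowered in some direction [l] and remain
   above both [p] and [q]. *)
have [|l szl] := mnm_lt_exists sz; first by apply: contraTneq z2r => <-; rewrite -leqNgt.
(* If [i'] differs from [l], then [u'] has the same exponent at [l] as [z], hence can be lowered
   there and remain above [p']. *)
have link i' u' p' : sh i' u' = z -> kept u'.2 p' -> (p' <= u'.1)%MM -> (p' l <= s l)%N ->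
    linked i' u' l ((z.1 - U_(l))%MM, z.2).
  move=> eu' kp' pu' p's; have [->|il] := eqVneq i' l; [by left|right].
  have u'l : u'.1 l = z.1 l by rewrite -eu' mnmDE mnm1E (negbTE il) addn0.
  exists ((u'.1 - U_(l))%MM, u'.2); split.
  - rewrite -eu' /sh /=; congr (_, _); apply/mnmP => e; rewrite !(mnmDE, mnmBE, mnm1E).
    have := u'l; case: (eqVneq l e) => [<-|]; last by rewrite !subn0.
    by rewrite (negbTE il) !addn0.
  - by rewrite sh_sub // u'l; apply: leq_ltn_trans szl.
  - apply/asboolP; exists p' => //; apply/mnm_lepP => e; rewrite mnmBE mnm1E.
    have := mnm_leE e pu'; case: (eqVneq l e) => [<- _|]; last by rewrite subn0.
    by rewrite u'l; lia.
exists l, ((z.1 - U_(l))%MM, z.2); split.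
- by rewrite sh_sub //; apply: leq_ltn_trans szl.
- by apply: link kp pu _ => //; rewrite sE leq_maxl.
- by apply: (link j w q) => //; rewrite ?ek // sE leq_maxr.
Qed.

(** * Construction of the extension *)

Variables (M : fieldType) (phi : L -> M) (t : T -> M).
Hypothesis phi_hom : hom_on E phi.

Local Notation W := (span (fun w => ~~ Lead w)).

(** In a nontrivial relation the term of greatest index could be solved for, making that index
    linear and so a leader. The induction runs downward from the greatest index. *)
Lemma nonlead_indep (c0 : L) (c : T -> L) : E c0 -> (forall w, E (c w)) ->
  c0 + \sum_(w <- lvl | ~~ Lead w) c w * av w = 0 ->
  c0 = 0 /\ forall w, w \in lvl -> ~~ Lead w -> c w = 0.
Proof.
move=> Ec0 Ec sum0; suff c_eq0 w : w \in lvl -> ~~ Lead w -> c w = 0.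
  split=> //; rewrite -sum0 big_seq_cond big1 ?addr0 // => w /andP[wl wN].
  by rewrite c_eq0 // mul0r.
pose B := (\max_(v <- lvl) tri_rank v)%N.
have [e] := ubnP (B - tri_rank w)%N; elim: e w => // e IHe w; rewrite ltnS => we wl wN.
apply: contrapT => /eqP cw; apply/negP: (wN); rewrite negbK.
apply/(Lead_lin (lvl_mdeg wl)).
have [s0 sD sM] := span_submod (fun u => tri_lt u w).
move: sum0; rewrite big_mkcond (bigD1_seq w) ?lvl_uniq //= wN addrCA => /eqP.
rewrite addr_eq0 => /eqP e_w; rewrite /lin -[av w](mulKf cw) e_w -mulN1r mulrA.
apply: (sM).
  apply: gen_field_mul; first exact: gen_field_inv (Ec w).
  by apply: gen_field_opp; apply: gen_field_1.
apply: (sD); first exact: span_E.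
rewrite big_seq_cond; apply: (big_ind _ s0 sD) => u /andP[ul uw].
case: ifP => [uN|_]; last exact: s0.
have /orP[lt_uw|lt_wu] := tri_lt_total uw.
  by apply: sM; [apply: Ec|apply: span_av; first exact: lvl_mdeg].
rewrite IHe ?mul0r //; apply: leq_trans we.
have uB : (tri_rank u <= B)%N by apply: (leq_bigmax_seq u).
by have := tri_rank_lt lt_wu; lia.
Qed.

(** Linear relations of leaders involve earlier generators, so substitution eliminates leaders
    without passing [v]; this bound is what later locates [b v]. *)
Lemma span_lower v : mdeg v.1 = (2 * r)%N -> span (fun w => ~~ Lead w && tri_le w v) (av v).
Proof.
elim/(@tri_ind m n): v => v IHv v2r.
have [Lv|Nv] := boolP (Lead v); last first.
  by apply: span_av; rewrite // Nv tri_le_eqVlt eqxx.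
move/(Lead_lin v2r): Lv; apply: span_sub => [||w w2r wv].
- exact: span_submod.
- by apply: span_E; apply: gen_field_1.
- apply: span_sub (IHv _ wv w2r) => [||u u2r /andP[Nu uw]].
  + exact: span_submod.
  + by apply: span_E; apply: gen_field_1.
  + apply: span_av; rewrite // Nu /=; apply: tri_le_trans uw _.
    by rewrite tri_le_eqVlt wv orbT.
Qed.

Lemma span_W (P : pred T) x : span P x -> W x.
Proof.
apply: span_sub => [||v v2r _]; first exact: span_submod.
  by apply: span_E; apply: gen_field_1.
apply: span_sub (span_lower v2r) => [||w w2r /andP[Nw _]].
- exact: span_submod.
- by apply: span_E; apply: gen_field_1.
- exact: span_av.
Qed.

(* The [E]-linear relations among [1] and the generators of level [2 * r] are
   the only ones that survive [theta]. *)
Lemma theta_exists : exists theta : L -> M,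
  [/\ (forall x, E x -> theta x = phi x),
      (forall x y, W x -> W y -> theta (x + y) = theta x + theta y),
      (forall b x, E b -> W x -> theta (b * x) = phi b * theta x)
    & (forall v, mdeg v.1 = (2 * r)%N -> ~~ Lead v -> theta (av v) = t v)].
Proof.
have [phi1 phiD phiM] := phi_hom.
(* [rep] expands an element of [W] in a basis over [E]; [val] replaces each basis vector [av w] by
   [t w]. Independence makes the passage well defined. *)
pose rep (c0 : L) (c : T -> L) := c0 + \sum_(w <- lvl | ~~ Lead w) c w * av w.
pose val (c0 : L) (c : T -> L) := phi c0 + \sum_(w <- lvl | ~~ Lead w) phi (c w) * t w.
have rep_inj c0 c c0' c' : E c0 -> (forall w, E (c w)) -> E c0' -> (forall w, E (c' w)) ->
    rep c0 c = rep c0' c' -> val c0 c = val c0' c'.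
  move=> Ec0 Ec Ec0' Ec' /eqP; rewrite -subr_eq0 /rep opprD addrACA -sumrB => /eqP.
  under eq_bigr do rewrite -mulrBl.
  case/nonlead_indep => [||/subr0_eq -> ecc'].
  - by apply: gen_field_add => //; apply: gen_field_opp.
  - by move=> w; apply: gen_field_add; [apply: Ec|apply/gen_field_opp/Ec'].
  congr (_ + _); rewrite big_seq_cond [RHS]big_seq_cond; apply: eq_bigr => w /andP[wl wN].
  by rewrite (subr0_eq (ecc' w wl wN)).
have : forall x, exists y, forall c0 c, E c0 -> (forall w, E (c w)) -> x = rep c0 c -> y = val c0 c.
  move=> x; have [[c0 [c [Ec0 Ec ex]]]|nx] := pselect (W x).
    by exists (val c0 c) => c0' c' Ec0' Ec' ex'; apply: rep_inj => //; rewrite -ex'; apply: esym ex.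
  by exists 0 => c0 c Ec0 Ec ex; case: nx; exists c0, c.
case/choice => theta thetaE; exists theta; split.
- move=> x Ex; have E0 : E 0 by apply: gen_field0.
  rewrite (thetaE x x (fun=> 0)) // /val ?big1 ?addr0 //.
    by move=> w _; rewrite (hom_on0 phi_hom) mul0r.
  by rewrite /rep big1 ?addr0 // => w _; rewrite mul0r.
- move=> x y [c0 [c [Ec0 Ec ex]]] [e0 [e [Ee0 Ee ey]]].
  rewrite (thetaE x c0 c) // (thetaE y e0 e) // (thetaE _ (c0 + e0) (fun w => c w + e w)).
  + rewrite /val phiD // addrACA -big_split /=; congr (_ + _).
    by apply: eq_bigr => w _; rewrite phiD // mulrDl.
  + exact: gen_field_add.
  + by move=> w; apply: gen_field_add; [apply: Ec|apply: Ee].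
  + rewrite ex ey /rep addrACA -big_split /=; congr (_ + _).
    by apply: eq_bigr => w _; rewrite mulrDl.
- move=> b x Eb [c0 [c [Ec0 Ec ex]]].
  rewrite (thetaE x c0 c) // (thetaE _ (b * c0) (fun w => b * c w)).
  + rewrite /val phiM // mulrDr mulr_sumr; congr (_ + _).
    by apply: eq_bigr => w _; rewrite phiM // mulrA.
  + exact: gen_field_mul.
  + by move=> w; apply: gen_field_mul; [|apply: Ec].
  + rewrite ex /rep mulrDr mulr_sumr; congr (_ + _).
    by apply: eq_bigr => w _; rewrite mulrA.
- move=> v v2r Nv; have vl := mem_lvl v2r.
  have sum_v (C : fieldType) (f : T -> C) :
      \sum_(w <- lvl | ~~ Lead w) (w == v)%:R * f w = f v.
    rewrite big_mkcond (bigD1_seq v) ?lvl_uniq //= Nv eqxx mul1r big1 ?addr0 // => w.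
    by move/negbTE ->; rewrite mul0r; case: ifP.
  rewrite (thetaE _ 0 (fun w => (w == v)%:R)) /val /rep ?sum_v ?add0r //.
  + rewrite (hom_on0 phi_hom) add0r -[RHS](sum_v _ t); apply: eq_bigr => w _.
    by case: eqP => _; rewrite ?phi1 ?(hom_on0 phi_hom).
  + exact: gen_field0.
  + by move=> w; case: eqP => _; [apply: gen_field_1|apply: gen_field0].
Qed.

Variable theta : L -> M.
Hypothesis theta_E : forall x, E x -> theta x = phi x.
Hypothesis thetaD : forall x y, W x -> W y -> theta (x + y) = theta x + theta y.
Hypothesis thetaZ : forall b x, E b -> W x -> theta (b * x) = phi b * theta x.
Hypothesis theta_t : forall v, mdeg v.1 = (2 * r)%N -> ~~ Lead v -> theta (av v) = t v.

(** The indices whose indeterminate stands for a generator; the derivations [Dy] vanish on every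
    other [t v]. *)
Definition free_idx v : bool := (2 * r <= mdeg v.1)%N && ~~ Lead v.

Lemma del_W i x : E x -> W (del i x).
Proof.
apply: (der_on_submod (T := W) (hom_on_id E) (del_der i)); first exact: span_submod.
apply: E_ind => [c|v v2r]; first by rewrite del_iota; apply: span_E; apply: E_iota.
rewrite del_av //; move: (v2r); rewrite leq_eqVlt => /orP[/eqP e|v2r'].
  by apply: (@span_W xpredT); apply: span_av; rewrite ?mdeg_sh.
by apply: span_E; apply: E_av; rewrite mdeg_sh.
Qed.

(** [del i] maps [E] into [W], where [theta] is linear over [E]; the composite is the derivation to
    be extended to [M]. *)
Lemma theta_der i : der_on E phi (fun x => theta (del i x)).
Proof.
have [delD delM] := del_der i; have [W0 WD WM] := span_submod (fun w => ~~ Lead w).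
split=> x y Ex Ey; first by rewrite delD // thetaD //; apply: del_W.
have Wx := del_W i Ex; have Wy := del_W i Ey.
rewrite delM // mulrC thetaD; [|exact: WM|exact: WM].
by rewrite !thetaZ // [phi y * _]mulrC.
Qed.

(** The table [y] of values on indeterminates stays a parameter, because [b] is built by derivations
    that use the part of [b] already known. *)
Variable Dy : 'I_m -> (T -> M) -> M -> M.
Hypothesis Dy_der : forall i y, der_on (fun=> True) id (Dy i y).
Hypothesis Dy_phi : forall i y x, E x -> Dy i y (phi x) = theta (del i x).
Hypothesis Dy_t : forall i y v, Dy i y (t v) = if free_idx v then y (sh i v) else 0.

(** Generators of the part of [M] in which [b v] will lie; this locality makes the recursion for [b]
    consistent. *)
Definition Ggens v (z : M) : Prop :=
  (exists2 c, E c & z = phi c) \/ (exists w, [/\ free_idx w, tri_le w v & z = t w]).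
Local Notation G v := (gen_field (Ggens v)).

Lemma G_phi v x : E x -> G v (phi x).
Proof. by move=> Ex; apply: gen_field_S; left; exists x. Qed.

Lemma G_t v w : free_idx w -> tri_le w v -> G v (t w).
Proof. by move=> Nw wv; apply: gen_field_S; right; exists w. Qed.

Lemma Ggens_ind v (P : M -> Prop) : (forall x, E x -> P (phi x)) ->
  (forall w, free_idx w -> tri_le w v -> P (t w)) -> forall z, Ggens v z -> P z.
Proof. by move=> Pphi Pt z [[c Ec ->]|[w [Nw wv ->]]]; [apply: Pphi|apply: Pt]. Qed.

Lemma G_mono v w x : tri_le v w -> G v x -> G w x.
Proof.
move=> vw; apply: gen_field_trans; apply: Ggens_ind => [y|u Nu uv]; first exact: G_phi.
by apply: G_t => //; apply: tri_le_trans vw.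
Qed.

Lemma theta_G v x (P : pred T) :
  (forall w, mdeg w.1 = (2 * r)%N -> ~~ Lead w -> P w -> tri_le w v) ->
  span (fun w => ~~ Lead w && P w) x -> G v (theta x).
Proof.
move=> Pv sx; have [W0 WD WM] := span_submod (fun w => ~~ Lead w).
suff [] : W x /\ G v (theta x) by [].
apply: (span_sub (Q := fun x => W x /\ G v (theta x))) sx => [||w w2r /andP[Nw Pw]].
- split.
  + by split; rewrite // theta_E ?(hom_on0 phi_hom); [exact: gen_field0|exact: gen_field0].
  + move=> y z [Wy Gy] [Wz Gz]; split; first exact: WD.
    by rewrite thetaD //; apply: gen_field_add.
  + move=> b y Eb [Wy Gy]; split; first exact: WM.
    by rewrite thetaZ //; apply: gen_field_mul => //; apply: G_phi.
- have E1 : E 1 by apply: gen_field_1.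
  by split; [apply: span_E|rewrite theta_E //; apply: G_phi].
- split; first exact: span_av.
  by rewrite theta_t //; apply: G_t; [rewrite /free_idx w2r leqnn|apply: Pv].
Qed.

(** * Recursive construction of [b] *)

(** An arbitrary direction leading down to a leader; that [b] does not depend on it follows from
    [D_b]. *)
Definition parent v : option 'I_m :=
  [pick i | (0 < v.1 i)%N && Lead ((v.1 - U_(i))%MM, v.2)].

Definition step (y : T -> M) v : M :=
  if (mdeg v.1 <= 2 * r)%N then theta (av v) else
  if parent v is Some i then Dy i y (y ((v.1 - U_(i))%MM, v.2)) else t v.

Definition below (y : T -> M) v : T -> M := fun w => if tri_lt w v then y w else 0.

(** Recursion along the order, with [s] as fuel; any amount above [tri_rank v] gives the same value
    at [v]. *)
Fixpoint stage s v : M := if s is s'.+1 then step (below (stage s') v) v else 0.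

Definition b v : M := stage (tri_rank v).+1 v.

Lemma stage_b s v : (tri_rank v < s)%N -> stage s v = b v.
Proof.
suff stage_eq : forall s s', (tri_rank v < s)%N -> (tri_rank v < s')%N -> stage s v = stage s' v.
  by move=> vs; apply: stage_eq.
elim/(@tri_ind m n): v {s} => v IHv [|s] [|s'] //= vs vs'.
apply: (congr1 (step ^~ v)); apply/funext => w; rewrite /below; case: ifP => // wv.
by apply: IHv => //; apply: leq_trans (tri_rank_lt wv) _.
Qed.

Lemma b_step v : b v = step (below b v) v.
Proof.
rewrite {1}/b /=; apply: (congr1 (step ^~ v)).
apply/funext => w; rewrite /below; case: ifP => // wv.
by apply: stage_b; apply: tri_rank_lt.
Qed.

Lemma b_low v : (mdeg v.1 <= 2 * r)%N -> b v = theta (av v).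
Proof. by move=> v2r; rewrite b_step /step v2r. Qed.

Lemma parent_some v i : parent v = Some i ->
  exists u, [/\ u = ((v.1 - U_(i))%MM, v.2), v = sh i u & Lead u].
Proof.
rewrite /parent; case: pickP => // j /andP[vj Lj] [<-].
by exists ((v.1 - U_(j))%MM, v.2); rewrite sh_sub.
Qed.

Lemma parent_none v : (2 * r < mdeg v.1)%N -> parent v = None -> ~~ Lead v.
Proof.
move=> v2r; rewrite /parent; case: pickP => // nex _; apply/negP => /asboolP[x kx xv].
have x2r : (mdeg x <= 2 * r)%N by case: kx => -[[]].
have [|i xvi] := mnm_lt_exists xv; first by apply: contraTneq v2r => <-; rewrite -leqNgt.
have := nex i; rewrite (leq_ltn_trans _ xvi) //= => /negP[]; apply/asboolP; exists x => //.
apply/mnm_lepP => e; rewrite mnmBE mnm1E.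
by have := mnm_leE e xv; case: (eqVneq i e) => [<- _|]; [lia|rewrite subn0].
Qed.

Lemma b_free v : free_idx v -> b v = t v.
Proof.
move=> /andP[v2r Nv]; rewrite b_step /step leq_eqVlt ltnNge v2r orbF.
case: eqP => [e|_]; first exact: theta_t.
case ev : (parent v) => [i|//]; have [u [_ e Lu]] := parent_some ev.
by case/negP: Nv; rewrite e; apply: Lead_sh.
Qed.

Lemma der_onT (B : M -> Prop) (D : M -> M) : der_on (fun=> True) id D -> der_on B id D.
Proof. exact: der_onS. Qed.

Lemma zero_submod (S : M -> Prop) : submod (gen_field S) id (fun x : M => x = 0).
Proof. by split=> [|x y -> ->|e x _ ->]; rewrite ?addr0 ?mulr0. Qed.

(** The difference of the two derivations kills [phi] of [E] and the free indeterminates up to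
    [v]. *)
Lemma Dy_agree i y1 y2 v x :
  (forall w, free_idx w -> tri_le w v -> y1 (sh i w) = y2 (sh i w)) ->
  G v x -> Dy i y1 x = Dy i y2 x.
Proof.
move=> y12 Gx; apply/eqP; rewrite -subr_eq0; apply/eqP.
have [D1D D1M] := Dy_der i y1; have [D2D D2M] := Dy_der i y2.
apply: (der_on_submod (T := fun x => x = 0) (del := fun x => Dy i y1 x - Dy i y2 x)
  (hom_on_id (G v)) _ _ _ Gx).
- split=> p q _ _; first by rewrite D1D // D2D //; ring.
  by rewrite D1M // D2M //=; ring.
- exact: zero_submod.
- apply: Ggens_ind => [z Ez|w Nw wv]; first by rewrite !Dy_phi // subrr.
  by rewrite !Dy_t Nw y12 // subrr.
Qed.

Lemma free_le_lead w u : free_idx w -> Lead u -> tri_le w u -> tri_lt w u.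
Proof.
by move=> /andP[_ Nw] Lu; rewrite tri_le_eqVlt => /orP[/eqP e|//]; rewrite e Lu in Nw.
Qed.

Lemma b_G v : G v (b v).
Proof.
elim/(@tri_ind m n): v => v IHv; rewrite b_step /step.
have [v2r|v2r] := leqP (mdeg v.1) (2 * r).
  move: v2r; rewrite leq_eqVlt => /orP[/eqP v2r|v2r].
    exact: theta_G (span_lower v2r).
  by rewrite theta_E; [apply: G_phi|]; apply: E_av.
case ev : (parent v) => [i|]; last first.
  by apply: G_t; rewrite /free_idx ?(ltnW v2r) ?parent_none // tri_le_eqVlt eqxx.
have [u [<- e Lu]] := parent_some ev.
have uv : tri_lt u v by rewrite e; apply: tri_lt_sh_self.
have uv' : tri_le u v by rewrite tri_le_eqVlt uv orbT.
have -> : below b v u = b u by rewrite /below uv.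
apply: (der_on_submod (T := G v) (hom_on_id (G u)) (der_onT _ (Dy_der i _))); last exact: IHv.
- split; [exact: gen_field0|exact: gen_field_add|].
  by move=> x y Gx; apply: gen_field_mul; apply: G_mono Gx.
- apply: Ggens_ind => [x Ex|w Nw wu].
    rewrite Dy_phi //; apply: (@theta_G v _ xpredT) => [w w2r _ _|].
      by rewrite tri_le_eqVlt tri_lt_mdeg ?w2r ?orbT.
    have := del_W i Ex; apply: span_sub => [||w w2r Nw].
    + exact: span_submod.
    + by apply: span_E; apply: gen_field_1.
    + by apply: span_av; rewrite ?Nw.
  (* The index [w] is free and [u] is a leader, so [w] strictly precedes [u] and its shift strictly
     precedes [v]. *)
  have wv : tri_lt (sh i w) v by rewrite e tri_lt_sh; apply: free_le_lead.
  rewrite Dy_t Nw /below wv; apply: G_mono (IHv _ wv).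
  by rewrite tri_le_eqVlt wv orbT.
Qed.

(** The truncated table may be replaced by [b], since [b u] involves only indeterminates strictly
    before the leader [u]. *)
Lemma b_lead v : (2 * r < mdeg v.1)%N -> Lead v ->
  exists i u, [/\ v = sh i u, Lead u & b v = Dy i b (b u)].
Proof.
move=> v2r Lv; rewrite b_step /step leqNgt v2r /=.
case ev : (parent v) => [i|]; last by have := parent_none v2r ev; rewrite Lv.
have [u [<- e Lu]] := parent_some ev; exists i, u; split=> //.
have uv : tri_lt u v by rewrite e; apply: tri_lt_sh_self.
have -> : below b v u = b u by rewrite /below uv.
apply: Dy_agree (b_G u) => w Nw wu; rewrite /below e tri_lt_sh.
by rewrite (free_le_lead Nw Lu wu).
Qed.

(** * Brackets and commutation *)

Local Notation D i := (Dy i b).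

Definition bracket i j x : M := D i (D j x) - D j (D i x).

Lemma bracket_der i j : der_on (fun=> True) id (bracket i j).
Proof.
have [DiD DiM] := Dy_der i b; have [DjD DjM] := Dy_der j b.
split=> x y _ _; rewrite /bracket.
  by rewrite !(DiD, DjD) //; ring.
by rewrite !(DiM, DjM) // !(DiD, DjD) // !(DiM, DjM) //=; ring.
Qed.

Lemma bracket_iota i j c : bracket i j (phi (iota c)) = 0.
Proof.
have De e c' : D e (phi (iota c')) = phi (iota (d e c')).
  by rewrite Dy_phi ?del_iota ?theta_E //; apply: E_iota.
by rewrite /bracket !De (dcomm.2 i j) subrr.
Qed.

Lemma D_phi_av i v : (mdeg v.1 < 2 * r)%N -> D i (phi (av v)) = b (sh i v).
Proof.
move=> v2r; rewrite Dy_phi; last exact: E_av.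
by rewrite del_av // b_low // mdeg_sh.
Qed.

Lemma D_t i v : free_idx v -> D i (t v) = b (sh i v).
Proof. by rewrite Dy_t => ->. Qed.

(* Both sides of a commutation [D_i b_v = b_(v + e_i)] are compared at leaders
   through the bracket, which kills everything that [b] of the leader is built from. *)
Lemma D_b z i u : z = sh i u -> D i (b u) = b z.
Proof.
elim/(@tri_ind m n): z i u => z IHz i u ez.
have [z2r|z2r] := leqP (mdeg z.1) (2 * r).
  have u2r : (mdeg u.1 < 2 * r)%N by rewrite -(mdeg_sh i) -ez.
  rewrite b_low; last exact: ltnW.
  by rewrite theta_E; [rewrite D_phi_av // ez|apply: E_av].
have u2r : (2 * r <= mdeg u.1)%N by rewrite -ltnS -(mdeg_sh i) -ez.
have [Lu|Nu] := boolP (Lead u); last first.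
  by have fu : free_idx u by [rewrite /free_idx u2r]; rewrite b_free // D_t // ez.
(* Every instance of the claim used for this interchange concerns an index before [z]. *)
have swap j l x : z = sh j (sh l x) -> Lead x -> D j (b (sh l x)) = D l (b (sh j x)).
  move=> ezx Lx.
  have lt_z e w : tri_lt w x -> tri_lt (sh e w) z.
    move=> wx; apply: (@tri_lt_trans _ _ _ (sh e x)); first by rewrite tri_lt_sh.
    by apply: tri_lt_mdeg; rewrite ezx !mdeg_sh.
  have D_sh e : (e = j) \/ (e = l) -> b (sh e x) = D e (b x).
    move=> ejl; apply/esym/IHz => //; case: ejl => ->; rewrite ezx ?tri_lt_sh_self //.
    by rewrite shC tri_lt_sh_self.
  have D_sh2 w : tri_lt w x -> D j (b (sh l w)) = b (sh j (sh l w)) /\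
      D l (b (sh j w)) = b (sh j (sh l w)).
    move=> wx; have wz : tri_lt (sh j (sh l w)) z by rewrite ezx !tri_lt_sh.
    by split; apply: IHz => //; rewrite shC.
  rewrite !D_sh; [|by left|by right].
  suff : bracket j l (b x) = 0 by move/eqP; rewrite subr_eq0 => /eqP.
  have kill_av w : (mdeg w.1 < 2 * r)%N -> tri_lt w x -> bracket j l (phi (av w)) = 0.
    move=> w2r /D_sh2[e1 e2]; rewrite /bracket !D_phi_av // e1 e2; exact: subrr.
  have kill_t w : free_idx w -> tri_lt w x -> bracket j l (t w) = 0.
    move=> fw /D_sh2[e1 e2]; rewrite /bracket !D_t // e1 e2; exact: subrr.
  have brphi : der_on E phi (fun y => bracket j l (phi y)).
    have [phi1 phiD phiM] := phi_hom; have [brD brM] := bracket_der j l.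
    by split=> y y' Ey Ey'; rewrite ?phiD ?phiM ?brD ?brM.
  have zeroE : submod E phi (fun y : M => y = 0).
    by split=> [|y y' -> ->|e y _ ->]; rewrite ?addr0 ?mulr0.
  (* From level [2 * r] on, [b x] is rational over [phi] of [E] and earlier indeterminates; below
     it, [b x] is the image of a generator separably algebraic over earlier ones. *)
  have [x2r|x2r] := leqP (2 * r) (mdeg x.1).
    have kill_E y : E y -> bracket j l (phi y) = 0.
      apply: (der_on_submod phi_hom brphi zeroE).
      apply: E_ind => [c|w w2r]; first exact: bracket_iota.
      by apply: kill_av => //; apply: tri_lt_mdeg; apply: leq_trans x2r.
    apply: (der_on_submod (T := fun y => y = 0) (hom_on_id (G x)) (der_onT _ (bracket_der j l))).
    - exact: zero_submod.
    - by apply: Ggens_ind => // w fw wx; apply: kill_t => //; apply: free_le_lead.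
    - exact: b_G.
  have Ex : E (av x) by apply: E_av.
  rewrite b_low; last exact: ltnW.
  rewrite theta_E //; have [_ sepx] := Lead_SL x2r Lx.
  apply: (der_on_sep phi_hom brphi zeroE _ _ Ex sepx).
    by move=> c; apply: FB_E.
  move=> c Fc; have FE y : FB x y -> E y by apply: FB_E.
  apply: (der_on_submod (T := fun y => y = 0) (hom_onS FE phi_hom) (der_onS FE brphi) _ _ Fc).
  - by split=> [|y y' -> ->|e y _ ->]; rewrite ?addr0 ?mulr0.
  - apply: FB_ind => [c'|w _ wx]; first exact: bracket_iota.
    by apply: kill_av => //; apply: leq_ltn_trans (tri_lt_mdegW wx) x2r.
have Lz : Lead z by rewrite ez; apply: Lead_sh.
(* The recursion reached [z] through a leader [w] that may differ from [u]; both routes are compared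
   with the one through [y]. *)
have [j [w [ezw Lw ->]]] := b_lead z2r Lz.
have eq_zz : sh i u = sh j w by rewrite -ez.
have [|l [y [ezy lu lw]]] := Lead_linked eq_zz _ Lu Lw; first by rewrite -ez.
have via e v : z = sh e v -> linked e v l y -> D e (b v) = D l (b y).
  move=> ezv [eel|[x [-> ex Lx]]].
    by move: ezv; rewrite ez -ezy eel => /sh_inj ->.
  by rewrite ex; apply: swap; rewrite // -ex.
by rewrite (via _ _ ez lu) (via _ _ ezw lw).
Qed.

Hypothesis M_gen : forall x,
  gen_field (fun z => (exists2 c, E c & z = phi c) \/ exists v, z = t v) x.

(** Generators suffice. On [phi (av v)] and free indeterminates, [D_b] sends both orders of
    differentiation to [b] at the same double shift; on constants the derivations [d] commute. *)
Lemma bracket0 i j x : bracket i j x = 0.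
Proof.
have [phi1 phiD phiM] := phi_hom; have [brD brM] := bracket_der i j.
apply: (der_on_submod (T := fun y => y = 0) (hom_on_id _)
  (der_onT _ (bracket_der i j)) _ _ (M_gen x)).
- exact: zero_submod.
have [D0i D0j] : D i 0 = 0 /\ D j 0 = 0.
  by split; apply: (der_on0 (S := fun=> True)); apply: der_onT; apply: Dy_der.
move=> z [[c Ec ->]|[v ->]]; last first.
  case fv : (free_idx v); last by rewrite /bracket !Dy_t fv D0i D0j subrr.
  by rewrite /bracket !D_t // !(D_b (erefl _)) shC subrr.
move: c Ec; apply: (der_on_submod (T := fun y => y = 0)
  (del := fun y => bracket i j (phi y)) phi_hom _ _).
- by split=> y y' Ey Ey'; rewrite ?phiD ?phiM ?brD ?brM.
- by split=> [|y y' -> ->|e y _ ->]; rewrite ?addr0 ?mulr0.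
apply: E_ind => [c|v v2r]; first exact: bracket_iota.
by rewrite /bracket !D_phi_av // !(D_b (erefl _)) shC subrr.
Qed.


Lemma compatible_extension :
  exists (iotaM : {rmorphism K -> M}) (D : 'I_m -> M -> M),
  [/\ commuting_derivations D,
      (forall i c, D i (iotaM c) = iotaM (d i c)),
      (forall x y, E x -> E y -> phi (x + y) = phi x + phi y /\ phi (x * y) = phi x * phi y),
      phi 1 = 1 /\ (forall c, phi (iota c) = iotaM c)
    & (forall i v, (mdeg v.1 + 1 < 2 * r)%N -> D i (phi (av v)) = phi (av (sh i v)))].
Proof.
have [phi1 phiD phiM] := phi_hom.
have zm : zmod_morphism (phi \o iota).
  move=> x y /=; rewrite rmorphB phiD ?(hom_onN phi_hom) //; try exact: E_iota.
  by apply: gen_field_opp; apply: E_iota.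
have mm : monoid_morphism (phi \o iota).
  by split=> [|x y] /=; rewrite ?rmorph1 // rmorphM phiM //; apply: E_iota.
pose iotaM : {rmorphism K -> M} := HB.pack (phi \o iota)
  (GRing.isZmodMorphism.Build _ _ (phi \o iota) zm)
  (GRing.isMonoidMorphism.Build _ _ (phi \o iota) mm).
exists iotaM, (fun i => Dy i b); split=> //.
- split=> [i|i j x]; last by apply/subr0_eq; apply: bracket0.
  have [DD DM] := Dy_der i b; split=> x y; [exact: DD|exact: DM].
- by move=> i c; rewrite /= Dy_phi ?del_iota ?theta_E //; apply: E_iota.
- by move=> x y Ex Ey; rewrite phiD // phiM.
- move=> i v; rewrite addn1 => v2r; have v2r' := ltnW v2r.
  by rewrite Dy_phi ?del_av ?theta_E //; apply: E_av; rewrite ?mdeg_sh.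
Qed.

End Extension.

Theorem theorem4p8 (m : nat) (K : fieldType) (d : 'I_m -> K -> K)
  (n r : nat) (L : fieldType) (iota : {rmorphism K -> L})
  (a : 'X_{1..m} -> 'I_n -> L) :
  (0 < m)%N -> commuting_derivations d -> (0 < n)%N -> (0 < r)%N ->
  differential_condition r iota a d ->
  (forall k : 'I_n,
     (forall sigma, min_sep_leader r iota a k sigma -> (mdeg sigma <= r)%N) \/
     (exists tau : 'X_{1..m}, mdeg tau = (2 * r)%N /\
        forall sigma, min_sep_leader r iota a k sigma -> (sigma <= tau)%MM)) ->
  exists (M : fieldType) (iotaM : {rmorphism K -> M}) (D : 'I_m -> M -> M)
         (phi : L -> M),
    [/\ commuting_derivations D,
        (forall i c, D i (iotaM c) = iotaM (d i c)),
        (* phi embeds the field K(a_h^xi : |xi| < 2r, h < n) into M over K *)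
        (forall x y, field_lt2r r iota a x -> field_lt2r r iota a y ->
           phi (x + y) = phi x + phi y /\ phi (x * y) = phi x * phi y),
        phi 1 = 1 /\ (forall c, phi (iota c) = iotaM c) &
        (forall (i : 'I_m) (k : 'I_n) (sigma : 'X_{1..m}),
           (mdeg sigma + 1 < 2 * r)%N ->
           D i (phi (a sigma k)) = phi (a (sigma + U_(i))%MM k))].
Proof.
move=> _ dcomm n0 r0 dc lead_b.
have [del Hdel] := choice (fun i => del_exists n0 r0 dcomm i dc).
have del_der i : der_on (field_lt2r r iota a) id (del i) by case: (Hdel i).
have del_iota i c : del i (iota c) = iota (d i c) by case: (Hdel i).
have del_av i (v : 'X_{1..m} * 'I_n) :
    (mdeg v.1 < 2 * r)%N -> del i (a v.1 v.2) = a (sh i v).1 (sh i v).2.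
  by case: (Hdel i) => _ _; apply.
have [M [phi [t [phi_hom M_gen M_der]]]] := InfinitePolynomials.free_extension
  (fun x => (exists c, x = iota c) \/ exists xi h, (mdeg xi < 2 * r)%N /\ x = a xi h)
  ('X_{1..m} * 'I_n)%type.
have [theta [theta_E thetaD thetaZ theta_t]] :=
  theta_exists n0 r0 del_der del_iota del_av t phi_hom.
(* Quantifying over pairs of a direction and a table lets one use of choice yield [Dy] for all
   tables. *)
have : forall p : 'I_m * ('X_{1..m} * 'I_n -> M), exists D : M -> M,
    [/\ der_on (fun=> True) id D,
        (forall x, field_lt2r r iota a x -> D (phi x) = theta (del p.1 x))
      & (forall v, D (t v) = if free_idx r iota a v then p.2 (sh p.1 v) else 0)].
  move=> [i y]; apply: M_der.
  exact: (theta_der del_der del_iota del_av thetaD thetaZ).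
case/choice => Dy HDy.
have Dy_der i y : der_on (fun=> True) id (Dy (i, y)) by case: (HDy (i, y)).
have Dy_phi i y x : field_lt2r r iota a x -> Dy (i, y) (phi x) = theta (del i x).
  by case: (HDy (i, y)) => _ H _; apply: H.
have Dy_t i y v : Dy (i, y) (t v) = if free_idx r iota a v then y (sh i v) else 0.
  by case: (HDy (i, y)).
have [iotaM [D [commD D_iota phi_mor phi_K D_phi]]] :=
  compatible_extension n0 r0 dcomm lead_b del_der del_iota del_av phi_hom
    theta_E thetaD thetaZ theta_t Dy_der Dy_phi Dy_t M_gen.
exists M, iotaM, D, phi; split=> // i k sigma.
exact: (D_phi i (sigma, k)).
Qed.
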